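(* Let $G$ be a planar graph containing no $4$-cycle (as a subgraph), and let $L$ be a list assignment of $G$ such that $|L(v)|\geq 8$ for every $v\in V(G)$. Then $\mathrm{diam}(\mathcal{G}(G,L))\leq 29|V(G)|$.
   Context: All graphs are finite, simple and undirected. A list assignment $L$ of $G$ assigns to each vertex $v$ a set $L(v)$ of colors; an $L$-coloring is a proper coloring $\alpha$ with $\alpha(v)\in L(v)$ for all $v$. The $L$-recoloring graph $\mathcal{G}(G,L)$ has the $L$-colorings of $G$ as vertices, two being adjacent iff they differ at exactly one vertex of $G$; $\mathrm{diam}$ denotes its diameter. *)

(* Defs.v *)
From mathcomp Require Import all_boot all_order all_algebra.
From mathcomp Require Import all_classical all_reals all_analysis.
Import Order.TTheory GRing.Theory Num.Theory.
Import numFieldNormedType.Exports.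

Set Implicit Arguments.
Unset Strict Implicit.
Unset Printing Implicit Defensive.

Local Open Scope ring_scope.
Local Open Scope classical_set_scope.

Definition arc_between (R : realType) (p q : R * R) (A : set (R * R)) : Prop :=
  exists f : R -> R * R,
    [/\ {within `[0, 1], continuous f},
        {in `[0, 1] &, injective f},
        f 0 = p, f 1 = q & A = f @` `[0, 1]].

(* The edge uv is indexed by the two-element finite set {u, v}, so an undirected
   edge carries a single arc; values of [arc] on non-edges are irrelevant. *)
Record plane_drawing (R : realType) (V : finType) (e : rel V)
    (pt : V -> R * R) (arc : {set V} -> set (R * R)) : Prop := PlaneDrawing {
  pt_inj : injective pt;
  arc_ends : forall u v, e u v -> arc_between (pt u) (pt v) (arc [set u; v]%SET);
  arc_avoids_vertices : forall u v w, e u v ->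
    arc [set u; v]%SET (pt w) -> w \in [set u; v]%SET;
  arcs_meet_at_common_ends : forall u v x y, e u v -> e x y ->
    [set u; v]%SET <> [set x; y]%SET ->
    arc [set u; v]%SET `&` arc [set x; y]%SET `<=`
      [set pt w | w in [set w | w \in [set u; v]%SET /\ w \in [set x; y]%SET]]
}.

Definition planar (R : realType) (V : finType) (e : rel V) : Prop :=
  exists (pt : V -> R * R) (arc : {set V} -> set (R * R)),
    plane_drawing e pt arc.

Definition has_4cycle (V : finType) (e : rel V) : Prop :=
  exists2 c : seq V, size c = 4%N & ucycle e c.

Section ListColoring.
Variables (V : finType) (e : rel V) (C : Type) (L : V -> set C).

Definition list_coloring (a : V -> C) : Prop :=
  (forall v, L v (a v)) /\ (forall u v, e u v -> a u <> a v).

Definition recoloring_vertex : Type := {a : V -> C | list_coloring a}.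

Definition recoloring_adj (a b : recoloring_vertex) : Prop :=
  exists! v : V, sval a v <> sval b v.

End ListColoring.

Section Diameter.
Variables (R : realType) (X : Type) (adj : X -> X -> Prop).

Inductive walk : nat -> X -> X -> Prop :=
| walk_nil x : walk 0 x x
| walk_step n x y z : adj x y -> walk n y z -> walk n.+1 x z.

(* Infimum of the walk lengths; +oo when x and y are not connected. *)
Definition gdist (x y : X) : \bar R :=
  ereal_inf [set (n%:R)%:E | n in [set n | walk n x y]].

Definition diam : \bar R := ereal_sup [set gdist x y | x in setT & y in setT].

End Diameter.

(* Main.v *)
Require Import Defs.
From mathcomp Require Import all_boot all_order all_algebra.
From mathcomp Require Import zify.

(* Discrete part.  Extending a recoloring sequence to a new vertex [v] with [d]
   neighbours costs about [m / (7 - d)] recolorings of [v], where [m] counts the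
   recolorings of its neighbours.  Hence a vertex of degree at most 3, and a
   4-vertex lying on two triangles with three neighbours of degree 4, can be
   removed without any vertex ever being recolored more than 29 times.

   Existence of such a configuration.  A plane drawing is approximated on a fine
   square grid, which exhibits the graph as a minor of the grid.  The unit squares
   generate the cycle space of the grid and each edge lies on two of them; this
   property survives deletion (merge the two squares) and contraction, so the
   cycle space of a planar graph is spanned by even edge sets covering each edge
   at most twice (MacLane).  At least [e - n + 1] of them are independent; without
   4-cycles each has at least 5 edges or is a triangle, and triangles are edge
   disjoint.  Counting gives [sum_v (9 d(v) - 2 t(v) - 30) < 0], [t(v)] being the
   number of edges at [v] that lie on triangles, and discharging concludes. *)

Set Implicit Arguments.
Unset Strict Implicit.
Unset Printing Implicit Defensive.

(** * Recoloring sequences *)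

(** A list of 8 colours leaves a free one as long as at most 7 are forbidden: a vertex with [d]
    present neighbours can avoid their colours together with the next [7 - d] colours they will
    take. Bounds are kept per vertex, because the cost of a new vertex is a sum over its neighbours.
    With 29, the reinsertion of the four vertices of the second configuration reproduces the bound;
    with 28, the last vertex would already need 29. The drawing consists of arbitrary continuous
    arcs, which may spiral infinitely often around a common end. The passage to the grid therefore
    uses two scales: squares around the vertices swallow the ends of the arcs, and a finer mesh,
    found by compactness, separates what is left. Faces of the minor are classes of unit squares,
    and only a lower bound for the rank of their boundary matrix is wanted. The spanning property
    provides it: the kernel of the incidence matrix has dimension at least [e - n + 1], also for a
    disconnected graph. *)

Section Recoloring.
Variables (V : finType) (e : rel V) (C : eqType) (L : V -> C -> Prop).
Hypothesis L8 : forall v, exists2 l : seq C,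
  uniq l /\ size l = 8 & forall c, c \in l -> L v c.

Definition upd (a : V -> C) (v : V) (c : C) : V -> C :=
  fun w => if w == v then c else a w.

(** A step may repeat the present colour of its vertex; [valid_walk] drops such steps. Only colours
    on [S] are constrained, so a sequence can be replayed after a vertex has been added. *)
Fixpoint valid (S : {set V}) (a : V -> C) (s : seq (V * C)) : Prop :=
  if s is p :: s' then
    [/\ p.1 \in S, L p.1 p.2, forall w, w \in S -> e p.1 w -> p.2 <> a w
      & valid S (upd a p.1 p.2) s']
  else True.

Definition final (a : V -> C) (s : seq (V * C)) : V -> C :=
  foldl (fun b p => upd b p.1 p.2) a s.

Definition steps_at (v : V) (s : seq (V * C)) : nat := count (fun p => p.1 == v) s.

Definition proper_on (S : {set V}) (a : V -> C) : Prop :=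
  (forall v, v \in S -> L v (a v)) /\
  (forall u v, u \in S -> v \in S -> e u v -> a u <> a v).

Definition nbrs_in (S : {set V}) (v : V) : {set V} := [set w in S | e v w].

Lemma fresh_color v (X : seq C) : size X <= 7 -> exists2 c, L v c & c \notin X.
Proof.
move=> sX; have [l [ul sl] Ll] := L8 v.
have [/hasP[c cl cX]|/hasPn h] := boolP (has (fun c => c \notin X) l).
  by exists c => //; apply: Ll.
have : size l <= size X.
  by apply: uniq_leq_size => // c /h; rewrite negbK.
by rewrite sl leqNgt ltnS sX.
Qed.

Definition nbr_colors (v : V) (s : seq (V * C)) : seq C :=
  [seq p.2 | p <- s & e v p.1].

Lemma final_ext s a b w : a w = b w -> final a s w = final b s w.
Proof.
elim: s a b => //= p s IH a b h; apply: IH; rewrite /upd; by case: eqP.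
Qed.

Lemma steps_nbr_sum S a v s : valid S a s ->
  size (nbr_colors v s) = \sum_(w in nbrs_in S v) steps_at w s.
Proof.
rewrite /nbr_colors size_map size_filter.
elim: s a => [|p s IH] a /=.
  by move=> _; rewrite big1.
case=> pS _ _ /IH ->.
rewrite [RHS](eq_bigr (fun w => (p.1 == w) + steps_at w s)) //.
rewrite big_split /=; congr addn.
have [h|h] := boolP (e v p.1).
  rewrite (bigD1 p.1) /=; last by rewrite inE pS h.
  rewrite eqxx big1 // => w /andP[_]; by rewrite eq_sym => /negbTE ->.
rewrite big1 // => w; rewrite inE => /andP[_ evw].
by case: eqP => // h'; rewrite h' evw in h.
Qed.

(* [j] counts the upcoming recolorings of neighbours of [v] already known to
   avoid the colour of [v]; a recoloring of [v] buys [l - 1] further ones. *)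
Lemma extend_lazy (S : {set V}) (v : V) (l : nat) :
  symmetric e -> v \notin S -> 0 < l -> #|nbrs_in S v| + l <= 7 ->
  forall (s : seq (V * C)) (a : V -> C) (j : nat),
  j < l -> valid S a s -> L v (a v) ->
  (forall w, w \in S -> e v w -> a v <> a w) ->
  a v \notin take j (nbr_colors v s) ->
  exists s' : seq (V * C),
    [/\ valid (v |: S) a s', [seq p <- s' | p.1 != v] = s,
        steps_at v s' * l <= size (nbr_colors v s) - j + (l - 1)
      & L v (final a s' v) /\
        forall w, w \in S -> e v w -> final a s' v <> final a s' w].
Proof.
move=> es vS l0 dl; elim=> [|[u c] s IH] a j jl /= va La pa aj.
  exists [::]; split=> //=; by rewrite /steps_at /=; lia.
case: va => uS Lc pc va.
have uv : u != v by apply: contraNneq vS => <-.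
(* [b] is [a] with [v] possibly recolored beforehand. The step [(u, c)] stays legal in [v |: S] if
   [b v] differs from [c] whenever [u] is a neighbour of [v]. *)
have step : forall (b : V -> C) (i : nat), i < l ->
    (forall w, w != v -> b w = a w) -> L v (b v) ->
    (forall w, w \in S -> e v w -> b v <> b w) -> (e v u -> b v <> c) ->
    b v \notin take i (nbr_colors v s) ->
    exists s' : seq (V * C),
    [/\ valid (v |: S) b ((u, c) :: s'), [seq p <- (u, c) :: s' | p.1 != v] = (u, c) :: s,
        steps_at v s' * l <= size (nbr_colors v s) - i + (l - 1)
      & L v (final (upd b u c) s' v) /\
        forall w, w \in S -> e v w -> final (upd b u c) s' v <> final (upd b u c) s' w].
  move=> b i il ba Lb pb buc bi.
  have bv : upd b u c v = b v by rewrite /upd eq_sym (negbTE uv).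
  have vb : valid S (upd b u c) s.
    suff H : forall t a1 b1, (forall w, w \in S -> a1 w = b1 w) ->
      valid S a1 t -> valid S b1 t.
      apply: H va => w wS; rewrite /upd; case: eqP => // _; rewrite ba //.
      by apply: contraNneq vS => <-.
    elim=> //= p t IHt a1 b1 ab [? ? pp ?]; split=> //.
      by move=> w wS ew; rewrite -ab //; apply: pp.
    by apply: IHt; last eassumption; move=> w wS; rewrite /upd; case: eqP => // _; exact: ab.
  have [|||s' [vs' fs' cs' ps']] := IH (upd b u c) i il vb.
  - by rewrite bv.
  - move=> w wS ew; rewrite bv /upd; case: eqP => [wu|_]; last exact: pb.
    by apply: buc; rewrite -wu.
  - by rewrite bv.
  exists s'; split=> //=; last by rewrite uv fs'.
  split=> //=; first by rewrite inE uS orbT.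
  move=> w; rewrite !inE => /orP[/eqP ->|wS] ew.
    by apply/nesym/buc; rewrite es.
  by rewrite ba; [exact: pc | apply: contraNneq vS => <-].
have cnt s' : steps_at v ((u, c) :: s') = steps_at v s'.
  by rewrite /steps_at /= (negbTE uv).
have [euv|neuv] := boolP (e v u); last first.
  have [||s' [vs' fs' cs' ps']] := step a j jl (fun _ _ => erefl) La pa.
  - by move=> h; rewrite h in neuv.
  - by move: aj; rewrite /nbr_colors /= (negbTE neuv).
  exists ((u, c) :: s'); split=> //; rewrite cnt.
  by rewrite /nbr_colors /= (negbTE neuv).
have nbE : nbr_colors v ((u, c) :: s) = c :: nbr_colors v s.
  by rewrite /nbr_colors /= euv.
rewrite nbE in aj *.
have [ac|/eqP ac] := eqVneq (a v) c; last first.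
  have [|||s' [vs' fs' cs' ps']] := step a j.-1 _ (fun _ _ => erefl) La pa.
  - by lia.
  - by [].
  - by case: (j) aj => [|j'] /=; rewrite ?take0 // inE negb_or => /andP[].
  exists ((u, c) :: s'); split=> //; rewrite cnt /=; lia.
(* The next neighbour takes the very colour of [v]: no protection is left and [v] has to move
   now. *)
have j0 : j = 0 by case: (j) aj => //= j'; rewrite inE ac eqxx.
(* Forbidden are the present colours of the neighbours and the next [l] colours they take, 7 at
   most. The step [(u, c)] uses up the first of these [l], hence [l.-1] below. *)
pose X := [seq a w | w <- enum (nbrs_in S v)] ++ take l (c :: nbr_colors v s).
have [|x Lx xX] := @fresh_color v X.
  rewrite size_cat size_map -cardE; have := size_take_min l (c :: nbr_colors v s); lia.
move: xX; rewrite mem_cat negb_or => /andP[/negP xn xt].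
have xnw w : w \in S -> e v w -> x <> a w.
  move=> wS ew xa; apply: xn; apply/mapP; exists w => //.
  by rewrite mem_enum inE wS ew.
have bv : upd a v x v = x by rewrite /upd eqxx.
have bw w : w != v -> upd a v x w = a w by rewrite /upd => /negbTE ->.
have wv w : w \in S -> w != v by move=> wS; apply: contraNneq vS => <-.
move: xt; rewrite -(prednK l0) /= inE negb_or => /andP[/eqP xc xt].
have [|||||s' [vs' fs' cs' ps']] := step (upd a v x) l.-1 _ bw.
- lia.
- by rewrite bv.
- by move=> w wS ew; rewrite bv bw ?wv //; exact: xnw.
- by rewrite bv => _.
- by rewrite bv.
exists ((v, x) :: (u, c) :: s'); split=> //=.
- split; [exact: setU11| by [] | | exact: vs'].
  move=> w; rewrite !inE => /orP[/eqP ->|wS] ew; last exact: xnw.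
  by rewrite ac; exact: xc.
- by rewrite eqxx /=; exact: fs'.
rewrite /steps_at /= eqxx (negbTE uv) /= add0n.
move: cs'; rewrite /steps_at mulnDl mul1n j0 /=.
(* If fewer than [l - 1] neighbour steps remain, the truncated difference is 0 and the bound forces
   that [v] never moves again; hence the case split. *)
case: (count _ s') => [|k]; rewrite ?mul0n ?mulSn (prednK l0); lia.
Qed.

Lemma steps_filter v w s : w != v ->
  steps_at w [seq p <- s | p.1 != v] = steps_at w s.
Proof.
move=> wv; rewrite /steps_at count_filter; apply: eq_count => p /=.
by case: eqP => //= ->.
Qed.

Lemma final_filter v w s a : w != v ->
  final a [seq p <- s | p.1 != v] w = final a s w.
Proof.
move=> wv; elim: s a => //= p s IH a.
case: (eqVneq p.1 v) => /= [pv|//]; rewrite IH; apply: final_ext.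
by rewrite /upd pv (negbTE wv).
Qed.

Lemma valid_rcons S a s v c : valid S a s -> v \in S -> L v c ->
  (forall w, w \in S -> e v w -> c <> final a s w) -> valid S a (rcons s (v, c)).
Proof.
elim: s a => [|p s IH] a /=; first by split.
by case=> ? ? ? vs vS Lc pc; split=> //; apply: IH.
Qed.

(** After the lazy sequence all neighbours of [v] wear their colours of [b], so one last step can
    give [v] the colour [b v]. That step is the [- 1] in the count. *)
Lemma extend_vertex (S : {set V}) (v : V) (l : nat) s a b :
  symmetric e -> irreflexive e -> v \notin S -> 0 < l -> #|nbrs_in S v| + l <= 7 ->
  proper_on (v |: S) a -> proper_on (v |: S) b ->
  valid S a s -> (forall w, w \in S -> final a s w = b w) ->
  exists s', [/\ valid (v |: S) a s', forall w, w \in v |: S -> final a s' w = b w,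
    forall w, w != v -> steps_at w s' = steps_at w s
    & (steps_at v s' - 1) * l <= \sum_(w in nbrs_in S v) steps_at w s + (l - 1)].
Proof.
move=> es ei vS l0 dl [La pa] [Lb pb] va fa.
have vvS : v \in v |: S by exact: setU11.
have SvS w : w \in S -> w \in v |: S by move=> h; rewrite inE h orbT.
have [|||s' [vs' fs' cs' [Lf pf]]] := @extend_lazy S v l es vS l0 dl s a 0 l0 va.
- exact: La.
- by move=> w wS; apply: pa => //; exact: SvS.
- by rewrite take0.
have wv w : w \in S -> w != v by move=> wS; apply: contraNneq vS => <-.
have fS w : w \in S -> final a s' w = b w.
  by move=> wS; rewrite -(fa w wS) -fs' final_filter ?wv.
exists (rcons s' (v, b v)); split.
- apply: valid_rcons => //; first exact: Lb.
  move=> w; rewrite !inE => /orP[/eqP -> |wS] ew; first by rewrite ei in ew.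
  by rewrite fS //; apply: pb => //; exact: SvS.
- move=> w; rewrite /final foldl_rcons -/(final a s') /upd /= inE => /orP[].
    by rewrite inE => h; rewrite h (eqP h).
  by move=> wS; rewrite (negbTE (wv _ wS)) fS.
- move=> w nw; rewrite -fs' steps_filter // /steps_at -cats1 count_cat /=.
  by rewrite eq_sym (negbTE nw) !addn0.
- rewrite -(steps_nbr_sum v va) {1}/steps_at -cats1 count_cat /= eqxx.
  by rewrite addn0 addnK -[size _]subn0.
Qed.

Definition reconfigurable (k : nat) (S : {set V}) : Prop :=
  forall a b, proper_on S a -> proper_on S b ->
  exists2 s, valid S a s /\ (forall w, w \in S -> final a s w = b w)
    & forall w, steps_at w s <= k.

Lemma proper_sub (S S' : {set V}) a : S' \subset S -> proper_on S a -> proper_on S' a.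
Proof.
move=> /subsetP h [La pa]; split=> [v vS|u v uS vS]; first by apply/La/h.
by apply: pa; apply: h.
Qed.

Hypotheses (e_sym : symmetric e) (e_irr : irreflexive e).

Lemma reconfigurable_deg3 (S : {set V}) v : v \in S -> #|nbrs_in S v| <= 3 ->
  reconfigurable 29 (S :\ v) -> reconfigurable 29 S.
Proof.
move=> vS d3 IH a b; rewrite -(setD1K vS) => pa pb.
have sub : S :\ v \subset v |: (S :\ v) by exact: subsetUr.
have [s [va fa] ks] := IH _ _ (proper_sub sub pa) (proper_sub sub pb).
have d3' : #|nbrs_in (S :\ v) v| <= 3.
  apply: leq_trans d3; apply/subset_leq_card/subsetP => w; rewrite !inE.
  by case/andP=> /andP[_ ->] ->.
(* With [l = 4] and [3 * 29 + 3 = 90], the new vertex moves at most [22 + 1 = 23] times. *)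
have [||s' [vs' fs' os' cs']] := @extend_vertex (S :\ v) v 4 s a b e_sym e_irr _ isT _ pa pb va fa.
- by rewrite !inE eqxx.
- lia.
exists s' => // w; have [->|wv] := eqVneq w v; last by rewrite os'.
have : \sum_(w in nbrs_in (S :\ v) v) steps_at w s <= #|nbrs_in (S :\ v) v| * 29.
  by rewrite -sum_nat_const; apply: leq_sum.
lia.
Qed.

(** Bounds the degree at reinsertion, when the neighbours in [A] are still missing. *)
Lemma card_nbrs_sub (S S' : {set V}) v (A : {set V}) :
  S' \subset S -> A \subset nbrs_in S v -> [disjoint A & S'] ->
  #|nbrs_in S' v| + #|A| <= #|nbrs_in S v|.
Proof.
move=> sS sA dA.
have dn : [disjoint nbrs_in S' v & A].
  apply/pred0P => x /=; apply/negP => /andP[]; rewrite inE => /andP[xS _] xA.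
  by move/pred0P/(_ x): dA => /=; rewrite xS xA.
rewrite -cardsUI (disjoint_setI0 dn) cards0 addn0.
apply/subset_leq_card; rewrite subUset sA andbT.
by apply/subsetP => w; rewrite !inE => /andP[/(subsetP sS) -> ->].
Qed.

Lemma sum_le_card (A : {set V}) (f : V -> nat) k :
  (forall w, f w <= k) -> \sum_(w in A) f w <= #|A| * k.
Proof. by move=> fk; rewrite -sum_nat_const; apply: leq_sum. Qed.

(* The constant 29 comes from the chain 23, 13, 19, 29 of bounds for z, x, y, w. *)
Lemma reconfigurable_bowtie (S : {set V}) w x y z :
  [/\ w \in S, x \in S, y \in S & z \in S] ->
  uniq [:: w; x; y; z] -> [/\ e w x, e w y, e w z & e x y] ->
  [/\ #|nbrs_in S w| <= 4, #|nbrs_in S x| <= 4, #|nbrs_in S y| <= 4 & #|nbrs_in S z| <= 4] ->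
  reconfigurable 29 (S :\: [set w; x; y; z]) -> reconfigurable 29 S.
Proof.
move=> [wS xS yS zS] /=; rewrite !inE !negb_or andbT.
case/and3P=> /and3P[wx wy wz] /andP[xy xz] yz [ewx ewy ewz exy] [dw dx dy dz] IH a b pa pb.
set S0 := S :\: _ in IH.
pose S1 := z |: S0; pose S2 := x |: S1; pose S3 := y |: S2.
have S4 : w |: S3 = S.
  apply/setP => u; rewrite !inE.
  have [->|_] := eqVneq u w; first by rewrite wS.
  have [->|_] := eqVneq u y; first by rewrite yS orbT.
  have [->|_] := eqVneq u x; first by rewrite xS !orbT.
  by have [->|_] := eqVneq u z; first by rewrite zS !orbT.
have sub3 : S3 \subset S by rewrite -S4 subsetUr.
have sub2 : S2 \subset S by apply: subset_trans sub3; exact: subsetUr.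
have sub1 : S1 \subset S by apply: subset_trans sub2; exact: subsetUr.
have sub0 : S0 \subset S by apply: subset_trans sub1; exact: subsetUr.
have [s0 [v0 f0] k0] := IH _ _ (proper_sub sub0 pa) (proper_sub sub0 pb).
(* The vertices return in the order [z], [x], [y], [w]. The first three still lack [w], and [x] also
   lacks [y], which permits [l = 4, 5, 4]; [w] comes last with all its neighbours and [l = 3]. *)
have c0 : #|nbrs_in S0 z| + 1 <= 4.
  apply: leq_trans dz; rewrite -(cards1 w); apply: card_nbrs_sub => //.
    by rewrite sub1set inE wS e_sym.
  by rewrite disjoints1 !inE eqxx.
have [||s1 [v1 f1 o1 c1]] := @extend_vertex S0 z 4 s0 a b e_sym e_irr _ isT _
  (proper_sub sub1 pa) (proper_sub sub1 pb) v0 f0.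
- by rewrite !inE eqxx !orbT.
- clear -c0; lia.
have h1 := @sum_le_card (nbrs_in S0 z) _ _ k0.
(* Each bound is one plus a quotient rounded down: [(87 + 3) / 4] here, then [(58 + 4) / 5] for [x],
   [(13 + 58 + 3) / 4] for [y] and [(23 + 13 + 19 + 29 + 2) / 3] for [w]. *)
have kz : steps_at z s1 <= 23 by clear -c0 c1 h1; lia.
have k1 u : steps_at u s1 <= 29.
  by have [->|uz] := eqVneq u z; [exact: leq_trans kz _ | rewrite o1].
have c2 : #|nbrs_in S1 x| + 2 <= 4.
  apply: leq_trans dx.
  have -> : 2 = #|[set w; y]| by rewrite cards2 wy.
  apply: card_nbrs_sub => //.
    by rewrite subUset !sub1set !inE wS yS exy e_sym ewx.
  apply/pred0P => u /=; rewrite !inE; apply/negP => /andP[/orP[]/eqP ->].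
    by rewrite (negbTE wz) eqxx.
  by rewrite (negbTE yz) eqxx !orbT.
have [||s2 [v2 f2 o2 c2']] := @extend_vertex S1 x 5 s1 a b e_sym e_irr _ isT _
  (proper_sub sub2 pa) (proper_sub sub2 pb) v1 f1.
- by rewrite !inE eqxx (negbTE xz) !orbT.
- clear -c2; lia.
have h2 := @sum_le_card (nbrs_in S1 x) _ _ k1.
have kx : steps_at x s2 <= 13 by clear -c2 c2' h2; lia.
have k2 u : steps_at u s2 <= 29.
  by have [->|ux] := eqVneq u x; [exact: leq_trans kx _ | rewrite o2].
have kz2 : steps_at z s2 <= 23 by rewrite o2 // eq_sym.
have c3 : #|nbrs_in S2 y| + 1 <= 4.
  apply: leq_trans dy; rewrite -(cards1 w); apply: card_nbrs_sub => //.
    by rewrite sub1set inE wS e_sym.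
  by rewrite disjoints1 !inE eqxx (negbTE wx) (negbTE wz).
have [||s3 [v3 f3 o3 c3']] := @extend_vertex S2 y 4 s2 a b e_sym e_irr _ isT _
  (proper_sub sub3 pa) (proper_sub sub3 pb) v2 f2.
- by rewrite !inE eqxx (negbTE yz) eq_sym (negbTE xy) !orbT.
- clear -c3; lia.
have xin : x \in nbrs_in S2 y by rewrite !inE eqxx e_sym.
rewrite (bigD1 x) //= in c3'.
have h3 : \sum_(i in nbrs_in S2 y | i != x) steps_at i s2 <= #|nbrs_in S2 y :\ x| * 29.
  rewrite (eq_bigl (mem (nbrs_in S2 y :\ x))); last by move=> u; rewrite !inE andbC.
  exact: sum_le_card.
rewrite (cardsD1 x) xin in c3.
have ky : steps_at y s3 <= 19 by clear -c3 c3' h3 kx; lia.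
have k3 u : steps_at u s3 <= 29.
  by have [->|uy] := eqVneq u y; [exact: leq_trans ky _ | rewrite o3].
have kx3 : steps_at x s3 <= 13 by rewrite o3.
have kz3 : steps_at z s3 <= 23 by rewrite o3 // eq_sym.
have wS3 : w \notin S3 by rewrite !inE eqxx (negbTE wx) (negbTE wy) (negbTE wz).
have c4 : #|nbrs_in S3 w| <= 4.
  apply: leq_trans dw; apply/subset_leq_card/subsetP => u; rewrite inE => /andP[uS ew].
  by rewrite inE (subsetP sub3).
have [|||s4 [v4 f4 o4 c4']] := @extend_vertex S3 w 3 s3 a b e_sym e_irr wS3 isT _ _ _ v3 f3.
- clear -c4; lia.
- by rewrite S4.
- by rewrite S4.
rewrite S4 in v4 f4.
have [yx zx zy] : [/\ y != x, z != x & z != y] by split; rewrite eq_sym.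
have inx : x \in nbrs_in S3 w by rewrite !inE ewx eqxx /= !orbT.
have iny : y \in nbrs_in S3 w :\ x by rewrite !inE yx ewy eqxx.
have inz : z \in nbrs_in S3 w :\ x :\ y.
  by rewrite !inE zx zy ewz eqxx /= !orbT.
rewrite (big_setD1 x inx) (big_setD1 y iny) (big_setD1 z inz) /= in c4'.
rewrite (cardsD1 x) inx (cardsD1 y) iny (cardsD1 z) inz in c4.
have h4 := @sum_le_card (nbrs_in S3 w :\ x :\ y :\ z) _ _ k3.
exists s4 => // u; have [->|uw] := eqVneq u w; last by rewrite o4.
clear -c4 c4' h4 kx3 ky kz3; lia.
Qed.

End Recoloring.

(** * Even edge sets and discharging *)

Ltac simpl_neq :=
  repeat match goal with H : is_true (negb (?a == ?b)) |- _ =>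
    rewrite ?(negbTE H) ?[b == a]eq_sym ?(negbTE H); clear H end;
  rewrite /= ?eqxx ?andbF ?orbF ?andbT.

Section Edges.
Variable V : finType.
Implicit Types (e : rel V) (u v w x : V).

Definition edges e : {set {set V}} :=
  [set a : {set V} | [exists u, exists v, e u v && (a == [set u; v])]].

Definition deg e v : nat := #|[set x | e v x]|.

(** A relation rather than a count, so that [deg], [edges] and [handshake] apply to triangle edges
    as well. *)
Definition in_triangle e : rel V :=
  fun v x => e v x && [exists y, e v y && e x y].

(** An element of the cycle space over the field with two elements. *)
Definition even_on e (B : {set {set V}}) : Prop :=
  B \subset edges e /\ forall v, ~~ odd #|[set a in B | v \in a]|.

Lemma eq_set2 u v w x :
  ([set u; v] == [set w; x]) = (u == w) && (v == x) || (u == x) && (v == w).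
Proof.
apply/eqP/idP => [h|/orP[]/andP[/eqP -> /eqP ->] //]; last by rewrite setUC.
have : u \in [set w; x] by rewrite -h set21.
have : v \in [set w; x] by rewrite -h set22.
have : w \in [set u; v] by rewrite h set21.
have : x \in [set u; v] by rewrite h set22.
rewrite !inE (eq_sym x u) (eq_sym x v) (eq_sym w u) (eq_sym w v).
by do 4!case: (_ == _).
Qed.

Lemma edgesP e a : reflect (exists u v, e u v /\ a = [set u; v]) (a \in edges e).
Proof.
rewrite inE; apply: (iffP existsP).
  by case=> u /existsP[v /andP[euv /eqP ->]]; exists u, v.
by case=> u [v [euv ->]]; exists u; apply/existsP; exists v; rewrite euv eqxx.
Qed.

Lemma mem_edges e u v : symmetric e -> ([set u; v] \in edges e) = e u v.
Proof.
move=> es; apply/edgesP/idP => [[x [y [exy /eqP]]]|h]; last by exists u, v.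
by rewrite eq_set2 => /orP[]/andP[/eqP -> /eqP ->] //; rewrite es.
Qed.

Lemma edge_at e a v : symmetric e -> a \in edges e -> v \in a ->
  exists2 w, e v w & a = [set v; w].
Proof.
move=> es /edgesP[x [y [exy ->]]]; rewrite !inE => /orP[]/eqP ->.
  by exists y.
by exists x; [rewrite es | rewrite setUC].
Qed.

Lemma handshake e : symmetric e -> irreflexive e ->
  \sum_v deg e v = 2 * #|edges e|.
Proof.
move=> es ei.
have dE v : deg e v = \sum_(a in edges e) (v \in a).
  rewrite /deg -big_mkcondr /= sum1dep_card.
  rewrite -(card_in_imset (f := fun x => [set v; x])); last first.
    move=> x y; rewrite !inE => evx evy /eqP; rewrite eq_set2.
    by case/orP=> /andP[/eqP h /eqP h'] //; rewrite h' h.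
  apply: eq_card => a; rewrite inE; apply/imsetP/andP => [[x + ->]|[aE va]].
    by rewrite inE => evx; rewrite mem_edges // set21.
  by have [w evw ->] := edge_at es aE va; exists w; rewrite // inE.
under eq_bigr do rewrite dE.
rewrite exchange_big /= mulnC -sum_nat_const.
apply: eq_bigr => a /edgesP[u [v [euv ->]]].
rewrite -big_mkcond /= sum1dep_card.
have -> : #|[set i | i \in [set u; v]]| = #|[set u; v]| by apply: eq_card => i; rewrite inE.
by rewrite cards2; case: eqP euv => // ->; rewrite ei.
Qed.

End Edges.

(** * Short even sets in graphs without 4-cycles *)

Section NoFourCycle.
Variables (V : finType) (e : rel V).
Hypotheses (es : symmetric e) (ei : irreflexive e).
Hypothesis no4 : forall a b c d,
  e a b -> e b c -> e c d -> e d a -> a != c -> b != d -> False.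

Lemma edge_neq u v : e u v -> u != v.
Proof. by apply: contraTneq => ->; rewrite ei. Qed.

Lemma even_next B u v : even_on e B -> [set u; v] \in B ->
  exists w, [/\ w != u, e v w & [set v; w] \in B].
Proof.
move=> [sB ev] uvB; have := ev v.
rewrite (cardsD1 [set u; v]) inE uvB set22 /= negbK => od.
have /card_gt0P[a] : 0 < #|[set a in B | v \in a] :\ [set u; v]| by case: #|_| od.
rewrite !inE => /andP[auv /andP[aB va]].
have [w evw aE] := edge_at es (subsetP sB _ aB) va.
exists w; split=> //; last by rewrite -aE.
by apply: contraNneq auv => wu; rewrite aE wu setUC.
Qed.

(** Inside an even set a walk can always go on without turning back. Either it closes up as a
    triangle after three edges, or it is prolonged at both ends and the absence of 4-cycles makes
    five of its edges distinct. *)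
Lemma even_small B : even_on e B -> B != set0 -> #|B| < 5 ->
  exists u v w, [/\ e u v, e v w, e w u & B = [set [set u; v]; [set v; w]; [set w; u]]].
Proof.
move=> evB /set0Pn[a0 a0B] B5.
have sBE : {subset B <= edges e} by apply/subsetP; case: evB.
have /edgesP[v0 [v1 [e01 a0E]]] := sBE _ a0B; rewrite a0E in a0B => {a0 a0E}.
have [v2 [n20 e12 b12]] := even_next evB a0B.
have [v3 [n31 e23 b23]] := even_next evB b12.
have [h|n30] := eqVneq v3 v0.
  rewrite {}h {n31 v3} in e23 b23.
  exists v0, v1, v2; split=> //; apply/eqP; rewrite eq_sym eqEcard.
  set T := _ :|: _.
  have sT : T \subset B by rewrite !subUset !sub1set a0B b12 b23.
  have T3 : #|T| = 3.
    rewrite /T -setUA cardsU1 !inE cards2 !eq_set2.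
    move/edge_neq: e01 => e01; move/edge_neq: e12 => e12; simpl_neq. done.
  rewrite sT T3 /= leqNgt; apply/negP => B4.
  (* A single edge [a] outside the triangle [T] must be continued at both ends by edges of [T]. So
     both ends are vertices of the triangle, and [a] is in [T] after all. *)
  have BT : #|B :\: T| = 1.
    move: (cardsID T B) B4 B5; rewrite (setIidPr sT) T3.
    by move: #|B| #|B :\: T| => m k; lia.
  have /cards1P[a BTa] : #|B :\: T| == 1 by rewrite BT.
  have : a \in B :\: T by rewrite BTa set11.
  rewrite inE => /andP[aT aB].
  have inT : forall p q, a = [set p; q] -> q \in [:: v0; v1; v2].
    move=> p q aE; rewrite aE in aB.
    have [w [nwp eqw bqw]] := even_next evB aB.
    have : [set q; w] \notin B :\: T.
      rewrite BTa inE aE eq_set2 negb_or (negbTE nwp) !andbF andbT /=.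
      by have /edge_neq := eqw; apply: contraNN => /andP[_ /eqP ->].
    rewrite inE bqw andbT negbK !inE !eq_set2.
    by case: (q == v0); case: (q == v1); case: (q == v2).
  have /edgesP[p [q [epq aE]]] := sBE _ aB.
  have := inT _ _ aE; have := inT q p; rewrite {1}aE setUC => /(_ erefl).
  move/edge_neq: epq; move/negP: aT; rewrite aE !inE => aT npq hp hq; apply: aT.
  move: hp hq npq => /or3P[]/eqP -> /or3P[]/eqP ->; rewrite ?eqxx ?eq_set2 ?eqxx ?orbT //=.
exfalso.
have [v4 [n42 e34 b34]] := even_next evB b23.
have [h|n40] := eqVneq v4 v0.
  by apply: (@no4 v0 v1 v2 v3) => //; rewrite 1?eq_sym // -h.
have b10 : [set v1; v0] \in B by rewrite setUC.
have [v5 [n51 e05 b05]] := even_next evB b10.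
have [h|n53] := eqVneq v5 v3.
  by apply: (@no4 v0 v1 v2 v3) => //; rewrite 1?eq_sym // es -h.
move: B5; rewrite ltnNge => /negP; apply.
pose l := [:: [set v0; v1]; [set v1; v2]; [set v2; v3]; [set v3; v4]; [set v0; v5]].
have ul : uniq l.
  rewrite /= !inE !eq_set2 !negb_or.
  move: (edge_neq e01) (edge_neq e12) (edge_neq e23) (edge_neq e34) (edge_neq e05).
  by move=> ? ? ? ? ?; simpl_neq.
rewrite -[5]/(size l) -(card_uniqP ul); apply/subset_leq_card/subsetP => a.
by rewrite !inE => /or4P[/eqP->|/eqP->|/eqP->|/orP[]/eqP->].
Qed.

(** Two different third vertices would close the 4-cycle [u w v w']. *)
Lemma triangle_uniq u v w w' : e u v -> e u w -> e v w -> e u w' -> e v w' -> w = w'.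
Proof.
move=> euv euw evw euw' evw'; apply/eqP; apply: contraT => ne; exfalso.
by apply: (@no4 u w v w') => //; rewrite 1?es // edge_neq.
Qed.

(** * Edge counts and discharging for a family of even sets *)

Section Rows.
Variables (k : nat) (B : 'I_k -> {set {set V}}).
Hypotheses (Binj : injective B) (Bev : forall i, even_on e (B i)).
Hypotheses (Bn0 : forall i, B i != set0).
Hypothesis B2 : forall a, #|[set i | a \in B i]| <= 2.
Hypothesis kge : #|edges e| + 1 <= k + #|V|.

Let tri i := #|B i| < 5.

Lemma triE i : tri i -> exists u v w,
  [/\ e u v, e v w, e w u & B i = [set [set u; v]; [set v; w]; [set w; u]]].
Proof. by move=> ti; apply: even_small. Qed.

(** Triangles sharing an edge have the same third vertex by [triangle_uniq], so they are the same
    edge set; [Binj] then identifies the indices. *)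
Lemma tri_uniq i j a : tri i -> tri j -> a \in B i -> a \in B j -> i = j.
Proof.
have key l p q : tri l -> [set p; q] \in B l ->
    exists w, [/\ e p q, e p w, e q w & B l = [set [set p; q]; [set p; w]; [set q; w]]].
  move=> /triE[u [v [w [euv evw ewu ->]]]].
  have rot (X Y Z : {set V}) : [set X; Y; Z] = [set Y; Z; X].
    by apply/setP => c; rewrite !inE -orbA orbC.
  have swp (X Y Z : {set V}) : [set X; Y; Z] = [set X; Z; Y].
    by rewrite -setUA (setUC [set Y]) setUA.
  rewrite !inE !eq_set2 -!orbA => /orP[|/orP[|/orP[|/orP[|/orP[]]]]] /andP[/eqP-> /eqP->].
  - exists w; split=> //; try by rewrite es.
    by rewrite swp (setUC [set w]).
  - exists w; split=> //; try by rewrite es.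
    by rewrite (setUC [set v] [set u]) (setUC [set w] [set u]).
  - exists u; split=> //; try by rewrite es.
    by rewrite rot swp (setUC [set u]).
  - exists u; split=> //; try by rewrite es.
    by rewrite rot (setUC [set w] [set v]) (setUC [set u] [set v]).
  - exists v; split=> //; try by rewrite es.
    by rewrite rot rot swp (setUC [set v] [set w]).
  - exists v; split=> //; try by rewrite es.
    by rewrite rot rot (setUC [set w] [set u]) (setUC [set v] [set w]).
move=> ti tj ai aj; apply: Binj.
have /edgesP[p [q [epq aE]]] : a \in edges e.
  by apply/(subsetP (proj1 (Bev i))).
rewrite aE in ai aj.
have [w [_ epw eqw ->]] := key _ _ _ ti ai.
have [w' [_ epw' eqw' ->]] := key _ _ _ tj aj.
by rewrite (triangle_uniq epq epw eqw epw' eqw').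
Qed.

Lemma sum_rows (P : pred 'I_k) :
  \sum_(i | P i) #|B i| = \sum_(a in edges e) #|[set i | P i & a \in B i]|.
Proof.
under eq_bigr => i _.
  rewrite -sum1_card (bigID (mem (edges e))) /= [X in _ + X]big1 ?addn0; last first.
    by move=> a /andP[aB]; rewrite (subsetP (proj1 (Bev i)) _ aB).
  rewrite big_mkcondl /=; over.
rewrite exchange_big /=; apply: eq_bigr => a _.
rewrite -sum1_card -big_mkcondr /=; apply: eq_bigl => i.
by rewrite inE.
Qed.

Lemma tri_edge i a : tri i -> a \in B i -> a \in edges (in_triangle e).
Proof.
move=> /triE[u [v [w [euv evw ewu ->]]]].
rewrite !inE -orbA => /or3P[]/eqP ->; apply/existsP.
- exists u; apply/existsP; exists v; rewrite eqxx andbT /in_triangle euv.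
  by apply/existsP; exists w; rewrite evw es ewu.
- exists v; apply/existsP; exists w; rewrite eqxx andbT /in_triangle evw.
  by apply/existsP; exists u; rewrite ewu es euv.
- exists w; apply/existsP; exists u; rewrite eqxx andbT /in_triangle ewu.
  by apply/existsP; exists v; rewrite euv es evw.
Qed.

Lemma in_triangle_sym : symmetric (in_triangle e).
Proof.
move=> u v; rewrite /in_triangle es; congr andb; apply/existsP/existsP => -[y];
by rewrite andbC => h; exists y.
Qed.

Lemma in_triangle_irr : irreflexive (in_triangle e).
Proof. by move=> u; rewrite /in_triangle ei. Qed.

(** [5 * k] is at most the total size of the rows plus 2 per triangle, hence at most
    [2 * E + 2 * E3 / 3] with [E3] triangle edges. Inserting [k >= E + 1 - n], multiplying by 6 and
    applying [handshake] yields the weights 9, 2 and 30. *)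
Lemma degree_sum_bound :
  \sum_v 9 * deg e v + 30 <= 30 * #|V| + \sum_v 2 * deg (in_triangle e) v.
Proof.
rewrite -!big_distrr /= handshake // handshake; [|exact: in_triangle_sym|exact: in_triangle_irr].
have s2 : \sum_i #|B i| <= 2 * #|edges e|.
  rewrite (sum_rows predT) mulnC -sum_nat_const; apply: leq_sum => a _.
  apply: leq_trans (B2 a); apply/subset_leq_card/subsetP => i; by rewrite !inE.
have s3 : \sum_(i | tri i) #|B i| <= #|edges (in_triangle e)|.
  rewrite sum_rows -sum1_card big_mkcond [X in _ <= X]big_mkcond /=.
  apply: leq_sum => a _; case: (a \in edges e) => //.
  have [->|/set0Pn[i]] := eqVneq [set i | tri i & a \in B i] set0.
    by rewrite cards0.
  rewrite inE => /andP[ti ai]; rewrite (tri_edge ti ai).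
  rewrite (_ : [set _ | _ & _] = [set i]) ?cards1 //; apply/setP => j.
  rewrite !inE; apply/andP/eqP => [[tj aj]|-> //].
  exact: tri_uniq aj ai.
have t3 i : tri i -> #|B i| = 3.
  move=> /triE[u [v [w [euv evw ewu ->]]]].
  rewrite -setUA cardsU1 !inE cards2 !eq_set2.
  by move: (edge_neq euv) (edge_neq evw) (edge_neq ewu) => ? ? ?; simpl_neq.
have s4 : 5 * k <= \sum_i #|B i| + 2 * \sum_(i | tri i) 1.
  rewrite mulnC -[X in X * _]card_ord -sum_nat_const big_distrr /=.
  rewrite [X in _ + X]big_mkcond /= -big_split /=; apply: leq_sum => i _.
  case ti: (tri i); first by rewrite t3.
  by rewrite addn0 leqNgt -/(tri i) ti.
have s5 : \sum_(i | tri i) #|B i| = 3 * \sum_(i | tri i) 1.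
  by rewrite big_distrr; apply: eq_bigr => i /t3 ->.
move: s2 s3 s4 s5 kge; move: (\sum_i #|B i|) (\sum_(i | tri i) #|B i|) (\sum_(i | tri i) 1) => X Y Z.
move: #|edges e| #|edges (in_triangle e)| #|V| => E E3 n. lia.
Qed.

Lemma light_configuration :
  (exists v, deg e v <= 3) \/
  (exists w x y z, [/\ uniq [:: w; x; y; z], [/\ e w x, e w y, e w z & e x y]
    & [/\ deg e w <= 4, deg e x <= 4, deg e y <= 4 & deg e z <= 4]]).
Proof.
have [/existsP[v d3]|/existsPn d4'] := boolP [exists v, deg e v <= 3].
  by left; exists v.
have d4 v : 3 < deg e v by rewrite ltnNge.
right.
(* For [d >= 4] the charge [9 d - 2 t - 30] is negative only if [d = t = 4], where it is [-2]. *)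
pose def v := (deg e v == 4) && (deg (in_triangle e) v == 4).
have [/existsP[w /andP[dw gw]]|/existsPn nodef] :=
    boolP [exists w, def w && (#|[set x | e w x & 4 < deg e x]| <= 1)].
  case/andP: dw => /eqP dw /eqP tw.
  pose N4 := [set x | e w x & deg e x <= 4].
  have cN : #|N4| + #|[set x | e w x & 4 < deg e x]| = 4.
    rewrite -[RHS]dw /deg -cardsUI (_ : _ :&: _ = set0) ?cards0 ?addn0.
      by apply: eq_card => x; rewrite !inE -andb_orr leqNgt orNb andbT.
    by apply/setP => x; rewrite !inE leqNgt; case: (4 < deg e x); rewrite ?andbF.
  have tri_all x : e w x -> exists2 y, e w y & e x y.
    move=> ewx.
    have /eqP E : [set x | in_triangle e w x] == [set x | e w x].
      rewrite eqEcard; apply/andP; split.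
        by apply/subsetP => y; rewrite !inE => /andP[].
      by rewrite -/(deg e w) -/(deg (in_triangle e) w) dw tw.
    have : x \in [set x | e w x] by rewrite inE.
    by rewrite -E inE => /andP[_ /existsP[y /andP[ewy exy]]]; exists y.
  have N43 : 3 <= #|N4| by lia.
  (* If the triangle mates [p'] and [q'] of two vertices [p] and [q] of [N4] both have degree above
     4, they coincide, since [w] has at most one such neighbour. Then [w p p' q] is a 4-cycle. *)
  have [x [y [xN yN exy]]] : exists x y, [/\ x \in N4, y \in N4 & e x y].
    have /card_gt1P[p [q [pN qN pq]]] : 1 < #|N4| by lia.
    have ewp : e w p by move: pN; rewrite inE => /andP[].
    have ewq : e w q by move: qN; rewrite inE => /andP[].
    have [p' ewp' epp'] := tri_all _ ewp.
    have [q' ewq' eqq'] := tri_all _ ewq.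
    have [p'N|p'N] := boolP (p' \in N4); first by exists p, p'.
    have [q'N|q'N] := boolP (q' \in N4); first by exists q, q'.
    exfalso; have p'q' : p' = q'.
      apply/eqP; apply: contraLR gw => ne; rewrite -ltnNge.
      apply/card_gt1P; exists p', q'; split=> //.
        by move: p'N; rewrite !inE ewp' /= ltnNge.
      by move: q'N; rewrite !inE ewq' /= ltnNge.
    apply: (@no4 w p p' q) => //; rewrite ?(edge_neq ewp') //.
      by rewrite es p'q'.
    by rewrite es.
  have /card_gt0P[z] : 0 < #|N4 :\ x :\ y|.
    have yNx : y \in N4 :\ x by rewrite inE yN inE eq_sym edge_neq.
    by have := cardsD1 x N4; have := cardsD1 y (N4 :\ x); rewrite xN yNx; lia.
  rewrite !inE => /and3P[zy zx /andP[ewz dz]].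
  move: xN yN; rewrite !inE => /andP[ewx dx] /andP[ewy dy].
  exists w, x, y, z; split=> //; last by rewrite dw.
  rewrite /= !inE !negb_or (edge_neq ewx) (edge_neq ewy) (edge_neq ewz) (edge_neq exy).
  by rewrite eq_sym zx eq_sym zy.
exfalso.
(* Every deficient vertex receives 1 from each of its neighbours of degree above 4, of which there
   are at least two. A giver has charge at least [7 * d - 30], which covers [d] gifts once
   [d >= 5]. *)
pose D v := #|[set x | e v x & def x]|.
have pt v : 30 + 2 * deg (in_triangle e) v + (4 < deg e v) * D v <= 9 * deg e v + 2 * def v.
  have h1 : deg (in_triangle e) v <= deg e v.
    by apply/subset_leq_card/subsetP => x; rewrite !inE => /andP[].
  have h2 : D v <= deg e v.
    by apply/subset_leq_card/subsetP => x; rewrite !inE => /andP[].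
  have := d4 v; have := erefl (def v); rewrite {1}/def.
  case: ltngtP (d4 v) => //= d; rewrite ?mul0n ?mul1n; case: (def v) => /=; lia.
have sD : 2 * \sum_v def v <= \sum_v (4 < deg e v) * D v.
  have -> : \sum_v (4 < deg e v) * D v = \sum_v \sum_x (4 < deg e v) * (e v x && def x).
    apply: eq_bigr => v _; rewrite -big_distrr /= /D -sum1dep_card.
    by congr muln; rewrite big_mkcond /=; apply: eq_bigr => x _; case: andb.
  rewrite exchange_big big_distrr /=; apply: leq_sum => x _.
  have := nodef x; rewrite negb_and -ltnNge; case: (def x) => //= h.
  rewrite muln1; apply: leq_trans h _; rewrite -sum1dep_card big_mkcond /=.
  by apply: leq_sum => v _; rewrite andbT es; case: (e v x); case: (4 < _).
have := degree_sum_bound.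
have : \sum_v (30 + 2 * deg (in_triangle e) v + (4 < deg e v) * D v)
     <= \sum_v (9 * deg e v + 2 * def v) by apply: leq_sum.
have -> : \sum_v (30 + 2 * deg (in_triangle e) v + (4 < deg e v) * D v) =
    #|V| * 30 + \sum_v 2 * deg (in_triangle e) v + \sum_v (4 < deg e v) * D v.
  rewrite big_split /=; congr addn; rewrite big_split /=; congr addn.
  by rewrite sum_nat_const.
have -> : \sum_v (9 * deg e v + 2 * def v) = \sum_v 9 * deg e v + 2 * \sum_v def v.
  by rewrite big_split /= [in RHS]big_distrr.
move: sD; move: (\sum_v (4 < _) * _) (\sum_v def v) => X Y.
move: (\sum_v 9 * _) (\sum_v 2 * _) #|V| => Z W n; lia.
Qed.

End Rows.
End NoFourCycle.

(** * Grid minors *)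

Import GRing.Theory.

Section GridMinors.
Local Open Scope ring_scope.

Lemma F2P (x : 'F_2) : x = 0 \/ x = 1.
Proof. by case: x => [[|[|]]] // i; [left | right]; apply/val_inj. Qed.

Ltac F2cases x := case: (F2P x) => ->.

Lemma addFF (x : 'F_2) : x + x = 0.
Proof. by F2cases x; apply/eqP. Qed.

Lemma addFE (x y : 'F_2) : (x + y == 0) = (x == y).
Proof. by F2cases x; F2cases y. Qed.

(** Off-diagonal terms come in equal pairs, which cancel in characteristic 2. *)
Lemma sum_sym2 (T : finType) (D : pred T) (f : T -> T -> 'F_2) :
  (forall x y, f x y = f y x) -> (forall x, f x x = 0) ->
  \sum_(x | D x) \sum_(y | D y) f x y = 0.
Proof.
move=> fs f0.
pose lt (x y : T) := (enum_rank x < enum_rank y)%N.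
have -> : \sum_(x | D x) \sum_(y | D y) f x y =
    \sum_(x | D x) \sum_(y | D y && lt x y) f x y
    + \sum_(x | D x) \sum_(y | D y && lt y x) f x y.
  rewrite -big_split /=; apply: eq_bigr => x _.
  rewrite (bigID (lt x)) /=; congr (_ + _).
  rewrite (bigID (lt^~ x)) /= [X in _ + X]big1 ?addr0; last first.
    move=> y /andP[/andP[_]]; rewrite /lt -!leqNgt => h1 h2.
    have /ord_inj/enum_rank_inj -> : enum_rank x = enum_rank y :> nat by lia.
    exact: f0.
  by apply: eq_bigl => y; rewrite /lt; case: (D y) => //=; lia.
rewrite [X in _ + X]pair_big_dep /= [X in X + _]pair_big_dep /=.
rewrite [X in _ + X](reindex_inj (h := fun p : T * T => (p.2, p.1))) /=; last first.
  by move=> [a b] [c d] [-> ->].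
rewrite [X in _ + X](eq_big (fun p : T * T => D p.1 && (D p.2 && lt p.1 p.2))
  (fun p => f p.1 p.2)); first by rewrite addFF.
  by move=> p; rewrite /= andbCA.
by move=> p _; rewrite fs.
Qed.

Definition nadj (p q : nat * nat) : bool :=
  [|| q == (p.1.+1, p.2), p == (q.1.+1, q.2), q == (p.1, p.2.+1) | p == (q.1, q.2.+1)].

(* The unit square with upper right corner [(i, j)] is the face [(i, j)]; [face1]
   and [face2] are the two faces on the sides of the grid edge [p q]. *)
Definition face1 (p q : nat * nat) : nat * nat :=
  if p.1 == q.1 then (p.1, (minn p.2 q.2).+1) else ((minn p.1 q.1).+1, p.2).
Definition face2 (p q : nat * nat) : nat * nat :=
  if p.1 == q.1 then (p.1.+1, (minn p.2 q.2).+1) else ((minn p.1 q.1).+1, p.2.+1).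

(** The boundary modulo 2 of the set of faces where [c] is 1: an edge counts if it separates the two
    values. *)
Definition cobd (c : nat * nat -> 'F_2) (p q : nat * nat) : 'F_2 :=
  c (face1 p q) + c (face2 p q).

Lemma nadjC p q : nadj p q = nadj q p.
Proof.
rewrite /nadj; do 4!case: (_ == _) => //=.
Qed.

Lemma cobdC c p q : nadj p q -> cobd c p q = cobd c q p.
Proof.
case: p q => [i j] [i' j']; rewrite /nadj /cobd /face1 /face2 /= !xpair_eqE.
case/or4P => /andP[/eqP h /eqP h']; rewrite h h' ?eqxx /= 1?minnC 1?[minn j' _]minnC //.
- by rewrite eqn_leq ltnn andbF /= eq_sym eqn_leq ltnn andbF minnC.
- by rewrite eqn_leq ltnn /= eq_sym eqn_leq ltnn /= minnC.
Qed.

Lemma cobd_right c i j : cobd c (i, j) (i.+1, j) = c (i.+1, j) + c (i.+1, j.+1).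
Proof.
rewrite /cobd /face1 /face2 /=.
have -> : (i == i.+1) = false by lia.
by have -> : minn i i.+1 = i by lia.
Qed.

Lemma cobd_up c i j : cobd c (i, j) (i, j.+1) = c (i, j.+1) + c (i.+1, j.+1).
Proof.
rewrite /cobd /face1 /face2 /= eqxx.
by have -> : minn j j.+1 = j by lia.
Qed.

(* [c] counts, modulo 2, the vertical edges of [z] to the left of a face. *)
Lemma even_grid_flow_cobd (z : nat * nat -> nat * nat -> 'F_2) :
  (forall p q, z p q = z q p) ->
  (forall j p, z (0%N, j) p = 0) -> (forall i p, z (i, 0%N) p = 0) ->
  (forall i j, z (i.+1, j.+1) (i.+2, j.+1) + z (i.+1, j.+1) (i, j.+1)
             + z (i.+1, j.+1) (i.+1, j.+2) + z (i.+1, j.+1) (i.+1, j) = 0) ->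
  exists c, forall p q, nadj p q -> cobd c p q = z p q.
Proof.
move=> zC z0l z0d zv.
pose w i j := z (i, j) (i, j.+1).
pose c (p : nat * nat) := \sum_(i < p.1) (if p.2 is j.+1 then w i j else 0).
have cS i j : c (i.+1, j.+1) = c (i, j.+1) + w i j by rewrite /c /= big_ord_recr.
have c0 i : c (i, 0%N) = 0 by rewrite /c big1.
have cV i j : cobd c (i, j) (i, j.+1) = z (i, j) (i, j.+1).
  by rewrite cobd_up cS addrA addFF add0r.
(* Vertical edges are right by construction of [c]. For horizontal ones, [z] vanishes at the left
   border, and evenness at a vertex carries the equation from its left edge to its right edge. *)
have cH i j : cobd c (i, j) (i.+1, j) = z (i, j) (i.+1, j).
  rewrite cobd_right; elim: i => [|i IH].
    rewrite z0l cS /w z0l addr0 /c /= big_ord0.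
    by case: j => [|j]; rewrite big_ord_recr big_ord0 /= ?/w ?z0l !addr0.
  rewrite cS; case: j IH => [|j] IH.
    move: IH; rewrite !c0 !add0r /w !z0d => ->; by rewrite addr0.
  rewrite cS; move: IH (zv i j).
  rewrite [z (i.+1, j.+1) (i, _)]zC [z (i.+1, j.+1) (i.+1, j)]zC -/(w _ _) -/(w _ _).
  move: (c (i.+1, j.+1)) (c (i.+1, j.+2)) (w i.+1 j) (w i.+1 j.+1).
  move: (z (i, j.+1) (i.+1, j.+1)) (z (i.+1, j.+1) (i.+2, j.+1)) => a b a1 a2 a3 a4 <-.
  by F2cases b; F2cases a1; F2cases a2; F2cases a3; F2cases a4;
    ((by move/eqP) || (by move=> _; apply/eqP)).
exists c => -[i j] [i' j'] adj.
have := adj; rewrite /nadj /= !xpair_eqE => /or4P[]/andP[/eqP h /eqP h']; subst.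
- exact: cH.
- by rewrite cobdC // cH.
- exact: cV.
- by rewrite cobdC // cV.
Qed.

(** * Finite grids *)

Section Grid.
Variable N : nat.
Definition toN (x : 'I_N * 'I_N) : nat * nat := (val x.1, val x.2).

Lemma toN_inj : injective toN.
Proof. by case=> [i j] [i' j'] [/val_inj -> /val_inj ->]. Qed.

Definition gadj (x y : 'I_N * 'I_N) : bool := nadj (toN x) (toN y).

Definition inner (x : 'I_N * 'I_N) : bool :=
  [&& 0 < x.1, x.1.+1 < N, 0 < x.2 & x.2.+1 < N]%N.

Lemma gadjC x y : gadj x y = gadj y x. Proof. exact: nadjC. Qed.

Lemma gadjxx x : gadj x x = false.
Proof. by rewrite /gadj /nadj; case: (toN x) => i j /=; rewrite !xpair_eqE; lia. Qed.

Lemma sum_gadj (f : nat * nat -> 'F_2) (x : 'I_N * 'I_N) i j : inner x ->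
  toN x = (i.+1, j.+1) -> \sum_(y | gadj x y) f (toN y) =
    f (i.+2, j.+1) + f (i, j.+1) + f (i.+1, j.+2) + f (i.+1, j).
Proof.
case: x => [x1 x2]; rewrite /inner /toN /= => /and4P[? hi ? hj] [Ei Ej].
have l1 : (i.+2 < N)%N by lia.
have l2 : (i < N)%N by lia.
have l3 : (i.+1 < N)%N by lia.
have m1 : (j.+2 < N)%N by lia.
have m2 : (j < N)%N by lia.
have m3 : (j.+1 < N)%N by lia.
have step (D : pred ('I_N * 'I_N)) (y : 'I_N * 'I_N) p : toN y = p -> D y ->
    \sum_(y | D y) f (toN y) = f p + \sum_(y | D y && (toN y != p)) f (toN y).
  move=> yp Dy; rewrite (bigD1 y) //= yp; congr (_ + _); apply: eq_bigl => y'.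
  by rewrite -yp (inj_eq toN_inj).
have gE y : gadj (x1, x2) y = (toN y \in [:: (i.+2, j.+1); (i, j.+1); (i.+1, j.+2); (i.+1, j)]).
  rewrite /gadj /nadj !inE /toN /= Ei Ej; case: y => [[y1 ?] [y2 ?]] /=.
  rewrite !xpair_eqE; lia.
rewrite (eq_bigl _ _ gE).
rewrite (step _ (Ordinal l1, Ordinal m3) (i.+2, j.+1)) //; last by rewrite inE eqxx.
rewrite (step _ (Ordinal l2, Ordinal m3) (i, j.+1)) //; last first.
  by rewrite !inE /toN /= !xpair_eqE; lia.
rewrite (step _ (Ordinal l3, Ordinal m1) (i.+1, j.+2)) //; last first.
  by rewrite !inE /toN /= !xpair_eqE; lia.
rewrite (step _ (Ordinal l3, Ordinal m2) (i.+1, j)) //; last first.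
  by rewrite !inE /toN /= !xpair_eqE; lia.
rewrite big1 ?addr0 ?addrA // => y; rewrite !inE => /andP[/andP[/andP[/andP[+ /negbTE h1] /negbTE h2] /negbTE h3] /negbTE h4].
by rewrite h1 h2 h3 h4.
Qed.

(** Each of the four faces around [x] borders two of the four edges at [x]. *)
Lemma sum_cobd c (x : 'I_N * 'I_N) : inner x ->
  \sum_(y | gadj x y) cobd c (toN x) (toN y) = 0.
Proof.
move=> ix; have [i [j xE]] : exists i j, toN x = (i.+1, j.+1).
  case: x ix => [[x1 h1] [x2 h2]]; rewrite /inner /toN /= => /and4P[? _ ? _].
  by exists x1.-1, x2.-1; rewrite !prednK.
rewrite (sum_gadj (cobd c (toN x)) ix xE) xE.
rewrite cobd_right cobd_up cobdC ?cobd_right; last by rewrite /nadj /= eqxx ?orbT.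
rewrite [cobd c (i.+1, j.+1) (i.+1, j)]cobdC ?cobd_up; last by rewrite /nadj /= eqxx ?orbT.
move: (c _) (c _) (c _) (c _) => a b d f.
by F2cases a; F2cases b; F2cases d; F2cases f; apply/eqP.
Qed.

End Grid.

(** * Cycle space of a minor of the grid *)

Section GridMinor.
Variables (V : finType) (e : rel V) (N : nat) (X : V -> {set 'I_N * 'I_N}).
Hypothesis ei : irreflexive e.
Hypothesis Xdisj : forall u v x, x \in X u -> x \in X v -> u = v.
Hypothesis Xinner : forall v x, x \in X v -> inner x.
Hypothesis Xconn : forall v x y, x \in X v -> y \in X v ->
  connect (fun a b => [&& a \in X v, b \in X v & gadj a b]) x y.
Variable rt : V -> 'I_N * 'I_N.
Hypothesis rtX : forall v, rt v \in X v.

Definition ev (i : 'I_#|edges e|) : {set V} := enum_val i.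
Lemma ev_inj : injective ev. Proof. exact: enum_val_inj. Qed.

Variables (us vs : 'I_#|edges e| -> V) (xs ys : 'I_#|edges e| -> 'I_N * 'I_N).
Hypothesis ends : forall i, [/\ e (us i) (vs i), ev i = [set us i; vs i],
  xs i \in X (us i), ys i \in X (vs i) & gadj (xs i) (ys i)].

(** The grid edges that survive deletion: those inside a branch set, which are contracted, and the
    one chosen for each edge of [e]. *)
Definition kept x y := gadj x y && ([exists v, (x \in X v) && (y \in X v)] ||
  [exists i, (x == xs i) && (y == ys i) || (x == ys i) && (y == xs i)]).

Lemma usvs i : us i != vs i.
Proof. by have [+ _ _ _ _] := ends i; apply: contraTneq => ->; rewrite ei. Qed.

Lemma kept_inner x y : kept x y -> inner x.
Proof.
case/andP=> _ /orP[/existsP[v /andP[h _]]|/existsP[i]]; first exact: Xinner h.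
have [_ _ hx hy _] := ends i.
by case/orP=> /andP[/eqP -> _]; [apply: Xinner hx | apply: Xinner hy].
Qed.

Lemma mem_ev v i : (v \in ev i) = (v == us i) || (v == vs i).
Proof. by have [_ -> _ _ _] := ends i; rewrite !inE. Qed.

Lemma sum_ev i (f : V -> 'F_2) : \sum_(v in ev i) f v = f (us i) + f (vs i).
Proof.
have [_ -> _ _ _] := ends i.
by rewrite big_setU1 ?big_set1 // inE usvs.
Qed.

(** Sum [cobd c] over the grid edges at all points of [X v]. Every point contributes 0, edges inside
    [X v] occur twice, and among the edges leaving [X v] only those chosen for the edges of [e] at
    [v] are kept. *)
Lemma cut_even c : (forall x y, gadj x y -> ~~ kept x y -> cobd c (toN x) (toN y) = 0) ->
  forall v, \sum_(i | v \in ev i) cobd c (toN (xs i)) (toN (ys i)) = 0.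
Proof.
move=> c0 v.
pose f (x y : 'I_N * 'I_N) : 'F_2 := if gadj x y then cobd c (toN x) (toN y) else 0.
have fC x y : f x y = f y x.
  by rewrite /f gadjC; case: ifP => // h; rewrite cobdC // nadjC.
have S0 : \sum_(x in X v) \sum_y f x y = 0.
  rewrite big1 // => x xv; rewrite -big_mkcond /=; apply: sum_cobd.
  exact: Xinner xv.
have S1 : \sum_(x in X v) \sum_(y | y \notin X v) f x y = 0.
  rewrite -[RHS]S0 [RHS](eq_bigr (fun x => \sum_(y in X v) f x y + \sum_(y | y \notin X v) f x y)).
    rewrite big_split /= sum_sym2 ?add0r // => x.
    by rewrite /f gadjxx.
  by move=> x _; rewrite (bigID (mem (X v))).
rewrite pair_big_dep /= in S1.
(* The chosen edge of [i], directed out of [X v]. *)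
pose tau i := if us i == v then (xs i, ys i) else (ys i, xs i).
have tauP i : v \in ev i -> [/\ (tau i).1 \in X v, (tau i).2 \notin X v
    & f (tau i).1 (tau i).2 = cobd c (toN (xs i)) (toN (ys i))].
  have [_ _ hx hy ga] := ends i.
  rewrite mem_ev eq_sym /tau; have [uv _|nuv] := eqVneq (us i) v.
    split=> /=; [by rewrite -uv | | by rewrite /f ga].
    by apply/negP => /(Xdisj hy)/eqP; rewrite -uv eq_sym (negbTE (usvs i)).
  move=> /= /eqP vv; split=> /=; [by rewrite vv | |by rewrite fC /f ga].
  by apply/negP => /(Xdisj hx)/eqP; rewrite (negbTE nuv).
have tau_inj : {in [pred i | v \in ev i] &, injective tau}.
  move=> i j _ _ tij; apply: ev_inj.
  have [_ -> hx hy _] := ends i; have [_ -> hx' hy' _] := ends j.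
  move: tij; rewrite /tau; case: ifP => _; case: ifP => _ [h1 h2].
  - by rewrite h1 in hx; rewrite h2 in hy; rewrite (Xdisj hx hx') (Xdisj hy hy').
  - by rewrite h1 in hx; rewrite h2 in hy; rewrite (Xdisj hx hy') (Xdisj hy hx') setUC.
  - by rewrite h1 in hy; rewrite h2 in hx; rewrite (Xdisj hx hy') (Xdisj hy hx') setUC.
  - by rewrite h1 in hy; rewrite h2 in hx; rewrite (Xdisj hx hx') (Xdisj hy hy').
rewrite -[RHS]S1 (bigID (mem [set tau i | i in [pred i | v \in ev i]])) /=.
rewrite [X in _ = _ + X]big1 ?addr0; last first.
  move=> [x y] /= /andP[/andP[xv yv] ni]; rewrite /f.
  case: ifP => // ga; apply: c0 => //; apply: contra ni.
  rewrite /kept ga /= => /orP[/existsP[u /andP[xu yu]]|/existsP[i xy]].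
    by move: yv; rewrite -(Xdisj xu xv) yu.
  have [_ _ hx hy _] := ends i.
  apply/imsetP; exists i.
    rewrite inE mem_ev; case/orP: xy => /andP[/eqP xE _]; rewrite xE in xv.
      by rewrite (Xdisj xv hx) eqxx.
    by rewrite (Xdisj xv hy) eqxx orbT.
  rewrite /tau; case/orP: xy => /andP[/eqP xE /eqP yE]; rewrite xE in xv; rewrite xE yE.
    by rewrite (Xdisj xv hx) eqxx.
  by rewrite (Xdisj xv hy) (negbTE (usvs i)).
rewrite (eq_bigl (mem [set tau i | i in [pred i | v \in ev i]])); last first.
  move=> p; rewrite /= andb_idl // => /imsetP[i iv ->].
  by have [-> -> _] := tauP i iv.
rewrite big_imset //=; apply: eq_bigr => i iv.
by have [_ _ ->] := tauP i iv.
Qed.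

Definition edge_flow x y (a b : 'I_N * 'I_N) : 'F_2 :=
  ((a == x) && (b == y) || (a == y) && (b == x))%:R.

Lemma edge_flowC x y a b : edge_flow x y a b = edge_flow x y b a.
Proof. by rewrite /edge_flow orbC andbC [X in _ || X]andbC. Qed.

Lemma edge_flow_bd x y a : x != y ->
  \sum_b edge_flow x y a b = (a == x)%:R + (a == y)%:R.
Proof.
move=> xy; rewrite /edge_flow.
have [->|ax] := eqVneq a x.
  rewrite (negbTE xy) (bigD1 y) //= eqxx orbF big1 ?addr0 // => b /negbTE ->.
  by [].
have [_|ay] := eqVneq a y; last by rewrite big1 ?addr0.
by rewrite (bigD1 x) //= eqxx big1 ?addr0 ?add0r // => b /negbTE ->.
Qed.

Lemma path_flow v x y : x \in X v -> y \in X v ->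
  exists psi : 'I_N * 'I_N -> 'I_N * 'I_N -> 'F_2,
  [/\ forall a b, psi a b = psi b a,
      forall a b, psi a b != 0 -> [&& a \in X v, b \in X v & gadj a b]
    & forall a, \sum_b psi a b = (a == x)%:R + (a == y)%:R].
Proof.
move=> xv yv; have /connectP[p + ->] := Xconn xv yv.
elim: p x {xv yv} => [|x' p IH] x /=.
  move=> _; exists (fun _ _ => 0); split=> // a.
  by rewrite big1 // addFF.
case/andP=> /and3P[xv xv' ga] /IH[psi [pC ps pb]].
exists (fun a b => psi a b + edge_flow x x' a b); split.
- by move=> a b; rewrite pC edge_flowC.
- move=> a b; have [->|/ps -> //] := eqVneq (psi a b) 0.
  rewrite add0r /edge_flow.
  case: orP => [[]/andP[/eqP -> /eqP ->] _|_]; last by rewrite eqxx.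
    by rewrite xv xv'.
  by rewrite xv xv' gadjC.
- move=> a; rewrite big_split /= pb edge_flow_bd; last first.
    by apply: contraTneq ga => ->; rewrite gadjxx.
  move: (_ == x)%:R (_ == x')%:R (_ == last _ _)%:R => r s t.
  by F2cases (r : 'F_2); F2cases (s : 'F_2); F2cases (t : 'F_2); apply/eqP.
Qed.

(** The chosen edge is prolonged inside both branch sets to the base points [rt]. With one base
    point per branch set, the boundaries of all edges at [v] meet in [rt v], so that lifts of even
    sets are even. *)
Lemma lift_edge i : exists psi : 'I_N * 'I_N -> 'I_N * 'I_N -> 'F_2,
  [/\ forall a b, psi a b = psi b a, forall a b, psi a b != 0 -> kept a b,
      forall a, \sum_b psi a b = (a == rt (us i))%:R + (a == rt (vs i))%:R
    & forall j, psi (xs j) (ys j) = (j == i)%:R].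
Proof.
have [_ evi hx hy ga] := ends i.
have [f [fC fs fb]] := path_flow hx (rtX (us i)).
have [g [gC gs gb]] := path_flow hy (rtX (vs i)).
exists (fun a b => f a b + g a b + edge_flow (xs i) (ys i) a b); split.
- by move=> a b; rewrite fC gC edge_flowC.
- move=> a b; have [->|/fs/and3P[au bu gab] _] := eqVneq (f a b) 0; last first.
    by rewrite /kept gab; apply/orP; left; apply/existsP; exists (us i); rewrite au.
  have [->|/gs/and3P[au bu gab] _] := eqVneq (g a b) 0; last first.
    by rewrite /kept gab; apply/orP; left; apply/existsP; exists (vs i); rewrite au.
  rewrite !add0r /edge_flow /kept; case: (boolP (_ || _)) => [h _|_]; last by rewrite eqxx.
  have -> : gadj a b by case/orP: h => /andP[/eqP -> /eqP ->] //; rewrite gadjC.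
  by apply/orP; right; apply/existsP; exists i.
- move=> a; rewrite !big_split /= fb gb edge_flow_bd; last first.
    by apply: contraTneq ga => ->; rewrite gadjxx.
  move: (_ == xs i)%:R (_ == rt (us i))%:R (_ == ys i)%:R (_ == rt (vs i))%:R => p q r s.
  by F2cases (p : 'F_2); F2cases (q : 'F_2); F2cases (r : 'F_2); F2cases (s : 'F_2); apply/eqP.
- move=> j; have [_ evj hx' hy' _] := ends j.
  have out v : ~~ ((xs j \in X v) && (ys j \in X v)).
    apply/negP => /andP[/(Xdisj hx') h1 /(Xdisj hy') h2].
    by have := usvs j; rewrite h1 h2 eqxx.
  have -> : f (xs j) (ys j) = 0.
    apply/eqP; apply: contraT => /fs/and3P[h1 h2 _].
    by have := out (us i); rewrite h1 h2.
  have -> : g (xs j) (ys j) = 0.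
    apply/eqP; apply: contraT => /gs/and3P[h1 h2 _].
    by have := out (vs i); rewrite h1 h2.
  rewrite !add0r /edge_flow; congr (_%:R); congr nat_of_bool.
  apply/idP/eqP => [|->]; last by rewrite !eqxx.
  move=> h; apply: ev_inj; rewrite [LHS]evj [RHS]evi.
  case/orP: h => /andP[/eqP h1 /eqP h2]; rewrite h1 in hx'; rewrite h2 in hy'.
    by rewrite (Xdisj hx hx') (Xdisj hy hy').
  by rewrite (Xdisj hx hy') (Xdisj hy hx') setUC.
Qed.

Lemma lift_cycle (z : 'I_#|edges e| -> 'F_2) :
  (forall v, \sum_(i | v \in ev i) z i = 0) ->
  exists c, (forall x y, gadj x y -> ~~ kept x y -> cobd c (toN x) (toN y) = 0) /\
    forall i, cobd c (toN (xs i)) (toN (ys i)) = z i.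
Proof.
move=> zev; have [psi psiP] := fin_all_exists lift_edge.
pose zeta a b := \sum_i z i * psi i a b.
have zetaC a b : zeta a b = zeta b a.
  by apply: eq_bigr => i _; have [-> _ _ _] := psiP i.
have zetak a b : ~~ kept a b -> zeta a b = 0.
  move=> nk; rewrite /zeta big1 // => i _; have [_ h _ _] := psiP i.
  have /eqP -> : psi i a b == 0 by apply: contraNT nk => /h.
  by rewrite mulr0.
have zetab a : \sum_b zeta a b = 0.
  rewrite exchange_big /=.
  transitivity (\sum_i \sum_(v in ev i) z i * (a == rt v)%:R).
    apply: eq_bigr => i _; rewrite -big_distrr /=; have [_ _ -> _] := psiP i.
    by rewrite sum_ev mulrDr.
  under eq_bigr do rewrite big_mkcond /=.
  rewrite exchange_big /= big1 // => v _; rewrite -big_mkcond /=.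
  by rewrite -big_distrl /= zev mul0r.
have zetae i : zeta (xs i) (ys i) = z i.
  rewrite /zeta (bigD1 i) //= big1 ?addr0.
    by have [_ _ _ ->] := psiP i; rewrite eqxx mulr1.
  by move=> j ji; have [_ _ _ ->] := psiP j; rewrite eq_sym (negbTE ji) mulr0.
(* [zeta] extended by 0 to all pairs of naturals: outside the grid the sums are empty. *)
pose Z p q := \sum_(a : 'I_N * 'I_N | toN a == p) \sum_(b : 'I_N * 'I_N | toN b == q) zeta a b.
have ZE a b : Z (toN a) (toN b) = zeta a b.
  rewrite /Z (big_pred1 a) ?(big_pred1 b) // => x; exact: inj_eq (@toN_inj N) _ _.
have Z0 p q : (forall a : 'I_N * 'I_N, toN a = p -> ~~ inner a) -> Z p q = 0.
  move=> h; rewrite /Z big1 // => a /eqP/h ia; rewrite big1 // => b _.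
  by apply: zetak; apply: contra ia; exact: kept_inner.
have [||||c cZ] := @even_grid_flow_cobd Z.
- by move=> p q; rewrite /Z exchange_big /=; do 2!apply: eq_bigr => ? _; rewrite zetaC.
- by move=> j p; apply: Z0 => a [h _]; rewrite /inner h.
- by move=> j p; apply: Z0 => a [_ h]; rewrite /inner h !andbF.
- move=> i j.
  have [/existsP[a /andP[/eqP aE ia]]|/existsPn h] :=
      boolP [exists a : 'I_N * 'I_N, (toN a == (i.+1, j.+1)) && inner a].
    rewrite -(sum_gadj (Z (i.+1, j.+1)) ia aE) -aE.
    rewrite (eq_bigr (zeta a)); last by move=> b _; exact: ZE.
    rewrite -[RHS](zetab a) [RHS](bigID (gadj a)) /= [X in _ = _ + X]big1 ?addr0 //.
    by move=> b nab; apply: zetak; rewrite /kept (negbTE nab).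
  rewrite !Z0 ?addr0 // => a aE; have := h a; by rewrite aE eqxx.
exists c; split=> [x y ga nk|i].
  by rewrite cZ // ZE zetak.
by have [_ _ _ _ ga] := ends i; rewrite cZ // ZE zetae.
Qed.

(** Squares to the right of or above the last grid line have a coordinate equal to [N]. *)
Notation face := ('I_N.+1 * 'I_N.+1)%type.

(** Deleting a grid edge merges the squares on its sides. The classes of [connect mergeC] are the
    faces of the minor, represented by [fingraph.root]. *)
Definition merged (f g : face) : bool :=
  [exists x : 'I_N * 'I_N, exists y : 'I_N * 'I_N, [&& gadj x y, ~~ kept x y
    & (toN f == face1 (toN x) (toN y)) && (toN g == face2 (toN x) (toN y))]].
Definition mergeC (f g : face) : bool := merged f g || merged g f.

Lemma mergeC_sym : connect_sym mergeC.
Proof. by apply: sym_connect_sym => f g; rewrite /mergeC orbC. Qed.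

(** Identically 0 if [r] is no representative; the zero rows this gives in [face_mx] are discarded
    with the choice of a free family. *)
Definition face_ind (r : face) (p : nat * nat) : 'F_2 :=
  [exists f : face, (toN f == p) && (fingraph.root mergeC f == r)]%:R.

Lemma face_indE r f : face_ind r (toN f) = (fingraph.root mergeC f == r)%:R.
Proof.
congr (nat_of_bool _)%:R; apply/existsP/idP => [[g /andP[/eqP/toN_inj ->]] //|h].
by exists f; rewrite eqxx.
Qed.

Lemma faces_of (x y : 'I_N * 'I_N) : exists f g : face,
  toN f = face1 (toN x) (toN y) /\ toN g = face2 (toN x) (toN y).
Proof.
case: x y => [[x1 h1] [x2 h2]] [[y1 k1] [y2 k2]].
rewrite /face1 /face2 /toN /=; case: ifP => _.
  have l1 : (x1 < N.+1)%N by lia.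
  have l2 : (x1.+1 < N.+1)%N by lia.
  have l3 : ((minn x2 y2).+1 < N.+1)%N by lia.
  by exists (Ordinal l1, Ordinal l3), (Ordinal l2, Ordinal l3).
have l1 : (x2 < N.+1)%N by lia.
have l2 : (x2.+1 < N.+1)%N by lia.
have l3 : ((minn x1 y1).+1 < N.+1)%N by lia.
by exists (Ordinal l3, Ordinal l1), (Ordinal l3, Ordinal l2).
Qed.

Lemma cobd_face_ind r (x y : 'I_N * 'I_N) (f g : face) :
  toN f = face1 (toN x) (toN y) -> toN g = face2 (toN x) (toN y) ->
  cobd (face_ind r) (toN x) (toN y) =
  (fingraph.root mergeC f == r)%:R + (fingraph.root mergeC g == r)%:R.
Proof. by move=> hf hg; rewrite /cobd -hf -hg !face_indE. Qed.

Lemma merged_root (x y : 'I_N * 'I_N) (f g : face) : gadj x y -> ~~ kept x y ->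
  toN f = face1 (toN x) (toN y) -> toN g = face2 (toN x) (toN y) ->
  fingraph.root mergeC f = fingraph.root mergeC g.
Proof.
move=> ga nk hf hg; apply/eqP; rewrite root_connect; last exact: mergeC_sym.
apply: connect1; apply/orP; left; apply/existsP; exists x; apply/existsP; exists y.
by rewrite ga nk hf hg !eqxx.
Qed.

Definition face_mx : 'M['F_2]_(#|{: face}|, #|edges e|) :=
  \matrix_(r, i) cobd (face_ind (enum_val r)) (toN (xs i)) (toN (ys i)).

Definition inc_mx : 'M['F_2]_(#|edges e|, #|V|) :=
  \matrix_(i, v) (enum_val v \in ev i)%:R.

Lemma face_mx_even r v : \sum_(i | v \in ev i) face_mx r i = 0.
Proof.
under eq_bigr do rewrite mxE.
apply: cut_even => x y ga nk; have [f [g [hf hg]]] := faces_of x y.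
by rewrite (cobd_face_ind _ hf hg) (merged_root ga nk hf hg) addFF.
Qed.

(** The spanning part of MacLane's criterion. A cycle lifts to the grid, where it is [cobd c]. As
    [cobd c] vanishes on deleted edges, [c] is constant on merged faces, and its values are the
    coefficients of the cycle on the rows of [face_mx]. *)
Lemma ker_inc_face_mx : (kermx inc_mx <= face_mx)%MS.
Proof.
apply/row_subP => j; set z := row j _.
have zinc : z *m inc_mx = 0 by rewrite -row_mul mulmx_ker row0.
have zev v : \sum_(i | v \in ev i) z 0 i = 0.
  transitivity ((z *m inc_mx) 0 (enum_rank v)); last by rewrite zinc mxE.
  rewrite mxE big_mkcond; apply: eq_bigr => i _; rewrite [inc_mx _ _]mxE enum_rankK.
  by case: (_ \in _); rewrite ?mulr1 ?mulr0.
have [c [ck ce]] := lift_cycle zev.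
have cr f : c (toN (fingraph.root mergeC f)) = c (toN f).
  have step g h : merged g h -> c (toN g) = c (toN h).
    case/existsP=> x /existsP[y /and3P[ga nk /andP[/eqP -> /eqP ->]]].
    by apply/eqP; rewrite -addFE; apply/eqP; exact: ck.
  have /connectP[p + ->] := connect_root mergeC f.
  elim: p f => //= g p IH f /andP[h /IH ->].
  by case/orP: h => /step ->.
apply/submxP; exists (\row_r c (toN (enum_val r : face))).
apply/rowP => i; rewrite -ce !mxE.
have [f [g [hf hg]]] := faces_of (xs i) (ys i).
have sel h : \sum_(r < #|{: face}|) c (toN (enum_val r : face)) *
    (fingraph.root mergeC h == enum_val r)%:R = c (toN h).
  rewrite -(cr h) (bigD1 (enum_rank (fingraph.root mergeC h))) //= enum_rankK eqxx mulr1.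
  rewrite big1 ?addr0 // => r nr; case: eqP => [hr|_]; last by rewrite mulr0.
  by rewrite hr enum_valK eqxx in nr.
rewrite /cobd -hf -hg -(sel f) -(sel g) -big_split /=; apply: eq_bigr => r _.
by rewrite !mxE (cobd_face_ind _ hf hg) mulrDr.
Qed.

(** The all-ones vector is in the kernel since every edge has two ends. This loss in the rank
    becomes the [+ 1] of [minor_rows]. *)
Lemma rank_inc_mx : (0 < #|V|)%N -> (\rank inc_mx < #|V|)%N.
Proof.
move=> V0; pose o : 'cV['F_2]_#|V| := const_mx 1.
have h : inc_mx *m o = 0.
  apply/colP => i; rewrite !mxE.
  transitivity (\sum_(v in ev i) (1 : 'F_2)); last by rewrite sum_ev addFF.
  rewrite (reindex (@enum_val _ (mem V))) /=; last first.
    by exists enum_rank => v _; rewrite ?enum_rankK ?enum_valK.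
  rewrite [RHS]big_mkcond /=; apply: eq_bigr => v _; rewrite !mxE mulr1.
  by case: ifP.
have := mulmx0_rank_max h.
have : (0 < \rank o)%N.
  rewrite lt0n mxrank_eq0; apply/eqP => /colP/(_ (Ordinal V0)); rewrite !mxE.
  by move/eqP; rewrite oner_eq0.
lia.
Qed.

Lemma natF2 n : n%:R = (odd n)%:R :> 'F_2.
Proof. by elim: n => // n IH; rewrite mulrS IH /=; case: odd; apply/eqP. Qed.

Lemma minor_rows : (0 < #|V|)%N -> exists (k : nat) (B : 'I_k -> {set {set V}}),
  [/\ injective B, forall i, even_on e (B i), forall i, B i != set0,
      forall a, (#|[set i | a \in B i]| <= 2)%N & (#|edges e| + 1 <= k + #|V|)%N].
Proof.
(* By [ker_inc_face_mx] the rank of [M] is at least [#|edges e| - \rank inc_mx]. Rows of a maximal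
   free family have distinct nonzero supports. *)
move=> V0; pose M := face_mx; pose f := maxrankfun M.
pose B (l : 'I_(\rank M)) : {set {set V}} := [set ev i | i in [set i | M (f l) i != 0]].
have BE l i : (ev i \in B l) = (M (f l) i != 0).
  by rewrite mem_imset ?inE //; exact: ev_inj.
have free : row_free (rowsub f M) by exact: maxrowsub_free.
have rowE l : delta_mx 0 l *m rowsub f M = row (f l) M.
  by rewrite -rowE; apply/rowP => i; rewrite !mxE.
have inj0 l l' : row (f l) M = row (f l') M -> l = l'.
  rewrite -!rowE => /(row_free_inj free)/rowP/(_ l); rewrite !mxE !eqxx /=.
  by case: eqP => // _ /eqP; rewrite oner_eq0.
exists (\rank M), B; split.
- move=> l l' BB; apply: inj0; apply/rowP => i; rewrite [LHS]mxE [RHS]mxE.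
  have key (x y : 'F_2) : (x != 0) = (y != 0) -> x = y by F2cases x; F2cases y.
  by apply: key; rewrite -!BE BB.
- move=> l; split.
    by apply/subsetP => a /imsetP[i _ ->]; exact: enum_valP.
  move=> v; have := face_mx_even (f l) v.
  rewrite (bigID (fun i => M (f l) i != 0)) /= [X in _ + X]big1; last first.
    by move=> i /andP[_]; rewrite negbK => /eqP.
  rewrite addr0 (eq_bigr (fun _ => 1)); last first.
    by move=> i /andP[_]; rewrite -/M; F2cases (M (f l) i).
  rewrite sumr_const natF2 => /eqP h.
  rewrite (_ : #|_| = #|[pred i | (v \in ev i) && (M (f l) i != 0)]|); last first.
    rewrite -(card_imset _ ev_inj); apply: eq_card => a; rewrite inE.
    apply/andP/imsetP => [[/imsetP[i] + ->]|[i + ->]].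
      by rewrite inE => Mi vi; exists i => //; rewrite inE /= vi.
    by rewrite inE => /andP[vi Mi]; rewrite BE.
  by move: h; case: odd.
- move=> l; apply/negP => /eqP B0.
  have /rowP/(_ l) : delta_mx 0 l = 0 :> 'rV['F_2]_(\rank M).
    apply: (row_free_inj free); rewrite rowE mul0mx; apply/rowP => i; rewrite [LHS]mxE [RHS]mxE; have := BE l i.
    by rewrite B0 inE => /esym/negbFE/eqP.
  by rewrite !mxE !eqxx => /eqP; rewrite oner_eq0.
- move=> a; have [aE|aE] := boolP (a \in edges e); last first.
    rewrite (_ : [set _ | _] = set0) ?cards0 //; apply/setP => l; rewrite !inE.
    by apply: contraNF aE => /imsetP[i _ ->]; exact: enum_valP.
  have [i ->] : exists i, a = ev i by exists (enum_rank_in aE a); rewrite /ev enum_rankK_in.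
  (* The column of an edge is nonzero only in the rows of the merged faces on its two sides. *)
  have [p [q [hp hq]]] := faces_of (xs i) (ys i).
  pose h l : face := enum_val (f l).
  have hinj : injective h by move=> l l' /enum_val_inj/maxrankfun_inj.
  rewrite -(card_imset _ hinj).
  apply: (@leq_trans #|[set fingraph.root mergeC p; fingraph.root mergeC q]|); last first.
    by rewrite cards2; case: eqP.
  apply/subset_leq_card/subsetP => r /imsetP[l + ->].
  rewrite inE BE mxE (cobd_face_ind _ hp hq) !inE -/(h l) !(eq_sym (h l)).
  by case: (_ p == h l) => //; case: (_ q == h l) => //; rewrite addr0 eqxx.
- have := mxrankS ker_inc_face_mx; rewrite mxrank_ker -/M.
  have := rank_inc_mx V0; lia.
Qed.

End GridMinor.

Lemma grid_minor_rows (V : finType) (e : rel V) (N : nat) (X : V -> {set 'I_N * 'I_N}) :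
  symmetric e -> irreflexive e -> (0 < #|V|)%N ->
  (forall u v x, x \in X u -> x \in X v -> u = v) ->
  (forall v x, x \in X v -> inner x) ->
  (forall v x y, x \in X v -> y \in X v ->
    connect (fun a b => [&& a \in X v, b \in X v & gadj a b]) x y) ->
  (forall v, exists x, x \in X v) ->
  (forall u v, e u v -> exists x y, [/\ x \in X u, y \in X v & gadj x y]) ->
  exists (k : nat) (B : 'I_k -> {set {set V}}),
  [/\ injective B, forall i, even_on e (B i), forall i, B i != set0,
      forall a, (#|[set i | a \in B i]| <= 2)%N & (#|edges e| + 1 <= k + #|V|)%N].
Proof.
move=> es ei V0 Xd Xi Xc X0 Xa.
have [rt rtX] := fin_all_exists X0.
have H (i : 'I_#|edges e|) : exists q : (V * V) * (('I_N * 'I_N) * ('I_N * 'I_N)),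
    [/\ e q.1.1 q.1.2, ev i = [set q.1.1; q.1.2],
      q.2.1 \in X q.1.1, q.2.2 \in X q.1.2 & gadj q.2.1 q.2.2].
  have /edgesP[u [v [euv evE]]] := enum_valP i.
  by have [x [y [xu yv ga]]] := Xa u v euv; exists ((u, v), (x, y)).
have [q qP] := fin_all_exists H.
exact: (@minor_rows V e N X ei Xd Xi Xc rt rtX _ _ _ _ qP V0).
Qed.

End GridMinors.

(** * From drawings to grid minors *)

From mathcomp Require Import all_classical all_reals all_analysis lra.
Import Order.TTheory GRing.Theory Num.Theory.
Import numFieldNormedType.Exports.

Section Drawings.
Local Open Scope ring_scope.

Lemma fin_uniform_pos (R : realType) (T : finType) (P : T -> R -> Prop) :
  (forall t x y, y <= x -> P t x -> P t y) ->
  (forall t, exists2 x, 0 < x & P t x) -> exists2 x, 0 < x & forall t, P t x.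
Proof.
move=> mono ex.
have ex' t : exists x, 0 < x /\ P t x by have [x] := ex t; exists x.
have [f fP] := fin_all_exists ex'.
exists (\big[Num.min/1]_t f t).
  by apply: lt_bigmin => // t _; case: (fP t).
by move=> t; apply: (mono t (f t)); [exact: bigmin_le | case: (fP t)].
Qed.

(** * Compactness and connectedness of arcs *)

Section Separation.
Local Open Scope classical_set_scope.
Variable R : realType.
Implicit Types K : set (R * R).

Lemma compact_separated K1 K2 : compact K1 -> compact K2 -> K1 `&` K2 = set0 ->
  exists2 d : R, 0 < d & forall x y, K1 x -> K2 y -> d <= `|x - y|.
Proof.
move=> c1 c2 dis.
have [[p [/= p1 p2]]|ne] := pselect (K1 `*` K2 !=set0); last first.
  exists 1 => // x y K1x K2y; exfalso; apply: ne; by exists (x, y).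
have [||q /set_mem[q1 q2] qmin] := @compact_EVT_min _ R (fun p => `|p.1 - p.2|) (K1 `*` K2) _ (compact_setX c1 c2).
- by exists p.
- apply: continuous_subspaceT => x.
  apply: (@continuous_comp _ _ _ (fun p : (R * R) * (R * R) => p.1 - p.2)); last exact: norm_continuous.
  by apply: (@continuousB _ _ _ fst snd); [exact: cvg_fst | exact: cvg_snd].
exists `|q.1 - q.2|.
  rewrite normr_gt0 subr_eq0; apply/eqP => qq.
  have : (K1 `&` K2) q.1 by split=> //; rewrite qq.
  by rewrite dis.
by move=> x y K1x K2y; apply: (qmin (x, y)); apply/mem_set; split.
Qed.

(** [Q] spreads over [d]-balls within [K], so the part of [K] where it holds and the part where it
    fails are both relatively open. *)
Lemma connected_chain_ind K (d : R) (Q : R * R -> Prop) p :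
  connected K -> 0 < d -> K p -> Q p ->
  (forall x y, K x -> K y -> `|x - y| < d -> Q x -> Q y) -> forall x, K x -> Q x.
Proof.
move=> cK d0 Kp Qp step.
have nb (x : R * R) : open (ball x d) by exact: ball_open.
have bE (x y : R * R) : ball x d y <-> `|x - y| < d by rewrite -ball_normE.
have -> : K = K `&` Q.
  apply/esym/cK.
  - by exists p.
  - exists (\bigcup_(x in K `&` Q) ball x d); first by apply: bigcup_open => x _; exact: nb.
    apply/seteqP; split=> x [Kx Qx]; split=> //.
      by exists x => //; apply/bE; rewrite subrr normr0.
    by case: Qx => y [Ky Qy] /bE h; apply: step h _.
  - exists (~` (\bigcup_(x in K `&` ~` Q) ball x d)).
      by apply: open_closedC; apply: bigcup_open => x _; exact: nb.
    apply/seteqP; split=> x [Kx Qx]; split=> //.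
      by case=> y [Ky nQy] /bE h; apply: nQy; apply: (step x y) => //; rewrite distrC.
    apply: contrapT => nQx; apply: Qx; exists x => //.
    by apply/bE; rewrite subrr normr0.
by move=> x [].
Qed.

Lemma arc_compact (p q : R * R) A : arc_between p q A -> compact A.
Proof.
by case=> f [fc _ _ _ ->]; apply: continuous_compact => //; exact: segment_compact.
Qed.

Lemma arc_connected (p q : R * R) A : arc_between p q A -> connected A.
Proof.
case=> f [fc _ _ _ ->]; apply: connected_continuous_connected => //.
exact: segment_connected.
Qed.

Lemma arc_start (p q : R * R) A : arc_between p q A -> A p.
Proof.
by case=> f [_ _ <- _ ->]; exists 0 => //=; rewrite in_itv /= lexx ler01.
Qed.

Lemma arc_stop (p q : R * R) A : arc_between p q A -> A q.
Proof.
by case=> f [_ _ _ <- ->]; exists 1 => //=; rewrite in_itv /= lexx ler01.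
Qed.

Lemma compact_norm_bound K : compact K -> exists2 M : R, 0 < M & forall x, K x -> `|x| <= M.
Proof.
move=> cK; have [Kne|ne] := pselect (K !=set0); last first.
  by exists 1 => // x Kx; exfalso; apply: ne; exists x.
have [|q _ qmax] := @compact_EVT_max _ R (fun p : R * R => `|p|) K Kne cK.
  by apply: continuous_subspaceT => x; exact: norm_continuous.
exists (`|q| + 1); first by rewrite ltr_wpDl.
move=> x Kx; apply: (le_trans (qmax x (mem_set Kx))); lra.
Qed.

End Separation.

(** Arcs with a common end come arbitrarily close to each other there, so [sep_arcs] only compares
    points at distance at least [r] from all vertices. The norm on [R * R] is the maximum norm:
    balls are squares. *)
Record separated_drawing (R : realType) (V : finType) (e : rel V)
    (pt : V -> R * R) (arc : {set V} -> set (R * R)) (r h M : R) : Prop := {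
  sep_h : 0 < h;
  sep_r : 4 * h <= r;
  sep_pt : forall u v, u != v -> 4 * r < `|pt u - pt v|;
  sep_pt_arc : forall u v w, e u v -> w \notin [set u; v] ->
    forall y, arc [set u; v] y -> 4 * r < `|pt w - y|;
  sep_arcs : forall u v u' v', e u v -> e u' v' -> [set u; v] <> [set u'; v'] ->
    forall y y', arc [set u; v] y -> arc [set u'; v'] y' ->
    (forall w, r <= `|pt w - y|) -> (forall w, r <= `|pt w - y'|) -> 4 * h < `|y - y'|;
  sep_bound_pt : forall v, `|pt v| <= M;
  sep_bound_arc : forall u v, e u v -> forall y, arc [set u; v] y -> `|y| <= M
}.

Lemma drawing_separated (R : realType) (V : finType) (e : rel V)
    (pt : V -> R * R) (arc : {set V} -> set (R * R)) :
  plane_drawing e pt arc -> exists r h M, separated_drawing e pt arc r h M.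
Proof.
move=> pd.
have cpt (u v : V) : e u v -> compact (arc [set u; v]).
  by move=> /(arc_ends pd)/arc_compact.
have [r1 r10 r1P] : exists2 x : R, 0 < x &
    forall t : V * V, t.1 != t.2 -> 4 * x < `|pt t.1 - pt t.2|.
  apply: fin_uniform_pos => [t x y yx h n|[u v] /=].
    by have := h n; lra.
  have [->|uv] := eqVneq u v; first by exists 1 => //; rewrite eqxx.
  have d0 : 0 < `|pt u - pt v|.
    by rewrite normr_gt0 subr_eq0; apply: contra uv => /eqP/(pt_inj pd) ->.
  exists (`|pt u - pt v| / 8) => [|_]; lra.
have [r2 r20 r2P] : exists2 x : R, 0 < x &
    forall t : V * V * V, e t.1.1 t.1.2 -> t.2 \notin [set t.1.1; t.1.2] ->
    forall y, arc [set t.1.1; t.1.2] y -> 4 * x < `|pt t.2 - y|.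
  apply: fin_uniform_pos => [t x y yx h e1 e2 z az|[[u v] w] /=].
    by have := h e1 e2 z az; lra.
  have [euv|] := boolP (e u v); last by exists 1.
  have [|wuv] := boolP (w \in [set u; v]); first by exists 1.
  have [||d d0 dP] := @compact_separated R (set1 (pt w)) (arc [set u; v]) (@compact_set1 _ _).
  - exact: cpt.
  - apply/seteqP; split=> // y [/= -> /(arc_avoids_vertices pd euv)].
    by rewrite (negbTE wuv).
  exists (d / 8) => [|_ _ y ay]; first by lra.
  by have := dP _ _ erefl ay; lra.
pose r := Num.min r1 r2.
have r0 : 0 < r by rewrite lt_min r10.
have rr1 : r <= r1 by rewrite ge_min lexx.
have rr2 : r <= r2 by rewrite ge_min lexx orbT.
pose far : set (R * R) := (\bigcap_(w in setT) [set y | r <= `|pt w - y|])%classic.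
have cfar : closed far.
  apply: closed_bigI => w _.
  have cont : continuous (fun y : R * R => `|pt w - y|).
    move=> x; apply: (@continuous_comp _ _ _ (fun y : R * R => pt w - y)); last exact: norm_continuous.
    by apply: (@continuousB _ _ _ (fun _ => pt w) id); [exact: cvg_cst | exact: cvg_id].
  exact: (preimage_closed (fun x _ => cont x) (@closed_ge R r)).
have [h1 h10 h1P] : exists2 x : R, 0 < x & forall t : (V * V) * (V * V),
    e t.1.1 t.1.2 -> e t.2.1 t.2.2 -> [set t.1.1; t.1.2] <> [set t.2.1; t.2.2] ->
    forall y y', arc [set t.1.1; t.1.2] y -> arc [set t.2.1; t.2.2] y' ->
    far y -> far y' -> 4 * x < `|y - y'|.
  apply: fin_uniform_pos => [t x x' xx H a b c y y' d f g i|[[u v] [u' v']] /=].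
    by have := H a b c y y' d f g i; lra.
  have [euv|] := boolP (e u v); last by exists 1.
  have [euv'|] := boolP (e u' v'); last by exists 1.
  have [E|ne] := pselect ([set u; v] = [set u'; v']); first by exists 1.
  have [|||d d0 dP] := @compact_separated R (setI (arc [set u; v]) far)
      (setI (arc [set u'; v']) far).
  - by apply: compact_closedI => //; exact: cpt.
  - by apply: compact_closedI => //; exact: cpt.
  - apply/seteqP; split=> // y [[ay fy] [ay' _]].
    have [w _ wy] := arcs_meet_at_common_ends pd euv euv' ne (conj ay ay').
    by have := fy w I; rewrite /= wy subrr normr0; lra.
  exists (d / 8) => [|_ _ _ y y' ay ay' fy fy']; first by lra.
  by have := dP y y' (conj ay fy) (conj ay' fy'); lra.
(* [fin_uniform_pos] yields small numbers, so the common upper bound is taken as the inverse of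
   one. *)
have [m m0 mP] : exists2 x : R, 0 < x & forall t : V * V, (`|pt t.1| <= x^-1) /\
    (e t.1 t.2 -> forall y, arc [set t.1; t.2] y -> `|y| <= x^-1).
  have inv (x y : R) : 0 < y -> y <= x -> x^-1 <= y^-1.
    by move=> y0 yx; rewrite lef_pV2 // posrE // (lt_le_trans y0).
  suff [x x0 H] : exists2 x : R, 0 < x & forall t : V * V, forall y, 0 < y -> y <= x ->
      (`|pt t.1| <= y^-1) /\ (e t.1 t.2 -> forall z, arc [set t.1; t.2] z -> `|z| <= y^-1).
    by exists x => // t; exact: H.
  apply: fin_uniform_pos => [t x y yx H z z0 zy|[u v] /=].
    by apply: H => //; exact: le_trans zy yx.
  have [M1 M10 M1P] := compact_norm_bound (@compact_set1 _ (pt u)).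
  have [M2 M20 M2P] : exists2 M : R, 0 < M & (e u v -> forall z, arc [set u; v] z -> `|z| <= M).
    have [euv|] := boolP (e u v); last by exists 1.
    by have [M M0 MP] := compact_norm_bound (cpt _ _ euv); exists M.
  have s0 : 0 < M1 + M2 by lra.
  exists (M1 + M2)^-1; first by rewrite invr_gt0.
  move=> y y0 ym; have := inv _ _ y0 ym; rewrite invrK => yM; split.
    by have := M1P (pt u) erefl; lra.
  by move=> euv z az; have := M2P euv z az; lra.
exists r, (Num.min h1 (r / 4)), m^-1; split.
- by rewrite lt_min h10; lra.
- have : Num.min h1 (r / 4) <= r / 4 by rewrite ge_min lexx orbT.
  lra.
- by move=> u v uv; have := r1P (u, v) uv => /=; lra.
- by move=> u v w euv wuv y ay; have := r2P (u, v, w) euv wuv y ay => /=; lra.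
- move=> u v u' v' euv euv' ne y y' ay ay' fy fy'.
  have : Num.min h1 (r / 4) <= h1 by rewrite ge_min lexx.
  have := h1P ((u, v), (u', v')) euv euv' ne y y' ay ay' (fun w _ => fy w) (fun w _ => fy' w).
  lra.
- by move=> v; case: (mP (v, v)).
- by move=> u v euv; case: (mP (u, v)) => _; apply.
Qed.

(** [q] is the stretch walked since the last visit to [A]: a further visit to [A] empties it, the
    first visit to [B] ends the search. *)
Lemma path_between (T : finType) (s : rel T) (A B : {set T}) (p : seq T) :
  [disjoint A & B] -> forall x q, x \in A -> (forall z, z \in q -> z \notin A :|: B) ->
  path s x (q ++ p) -> last x (q ++ p) \in B ->
  exists x' q' y, [/\ x' \in A, y \in B, path s x' (rcons q' y)
    & forall z, z \in q' -> z \notin A :|: B].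
Proof.
move=> dAB; elim: p => [|z p IH] x q xA qout.
  rewrite cats0 => _; case/lastP: q qout => [|q z] qout /=.
    by move=> xB; move/pred0P/(_ x): dAB => /=; rewrite xA xB.
  rewrite last_rcons => zB; have := qout z.
  by rewrite mem_rcons mem_head inE zB orbT => /(_ isT).
rewrite -cat_rcons => pth lst.
have [zB|zB] := boolP (z \in B).
  by exists x, q, z; split=> //; move: pth; rewrite cat_path => /andP[].
have [zA|zA] := boolP (z \in A).
  move: pth lst; rewrite cat_path last_cat last_rcons => /andP[_ pz] lz.
  exact: (IH z [::]).
apply: (IH x (rcons q z)) => // y; rewrite mem_rcons inE => /orP[/eqP ->|]; last exact: qout.
by rewrite inE negb_or zA.
Qed.

Lemma path_all_target (T : eqType) (s : rel T) (Q : pred T) x p :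
  (forall a b, s a b -> Q b) -> path s x p -> all Q p.
Proof. by move=> sQ; elim: p x => //= y p IH x /andP[/sQ -> /IH]. Qed.

Section Grid.
Variables (N : nat).
Notation P := ('I_N * 'I_N)%type.

Definition adj_in (D : {set P}) (a b : P) : bool := [&& a \in D, b \in D & gadj a b].

Lemma adj_in_sym D : symmetric (adj_in D).
Proof. by move=> a b; rewrite /adj_in gadjC andbCA. Qed.

Lemma adj_in_sub (D D' : {set P}) a b : D \subset D' ->
  connect (adj_in D) a b -> connect (adj_in D') a b.
Proof.
move=> /fintype.subsetP sD; apply: connect_sub => x y /and3P[xD yD ga]; apply: connect1.
by rewrite /adj_in !sD.
Qed.

Lemma connect_row (D : {set P}) (j : 'I_N) n : forall i i' : 'I_N, i' = (i + n)%N :> nat ->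
  (forall k : 'I_N, (i <= k <= i')%N -> (k, j) \in D) -> connect (adj_in D) (i, j) (i', j).
Proof.
elim: n => [|n IH] i i' h hD.
  by have -> : i' = i by apply: val_inj; rewrite /= h addn0.
have l : (i.+1 < N)%N by have := ltn_ord i'; lia.
apply: (connect_trans (y := (Ordinal l, j))).
  apply: connect1; rewrite /adj_in !hD /=; try by lia.
  by rewrite /gadj /nadj /toN /= eqxx.
by apply: IH => [|k hk]; [rewrite /= h; lia | apply: hD; move: hk => /=; lia].
Qed.

Lemma connect_col (D : {set P}) (i : 'I_N) n : forall j j' : 'I_N, j' = (j + n)%N :> nat ->
  (forall k : 'I_N, (j <= k <= j')%N -> (i, k) \in D) -> connect (adj_in D) (i, j) (i, j').
Proof.
elim: n => [|n IH] j j' h hD.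
  by have -> : j' = j by apply: val_inj; rewrite /= h addn0.
have l : (j.+1 < N)%N by have := ltn_ord j'; lia.
apply: (connect_trans (y := (i, Ordinal l))).
  apply: connect1; rewrite /adj_in !hD /=; try by lia.
  by rewrite /gadj /nadj /toN /= eqxx !orbT.
by apply: IH => [|k hk]; [rewrite /= h; lia | apply: hD; move: hk => /=; lia].
Qed.

Lemma gadj_row (a b c : 'I_N) : (a <= b.+1)%N -> (b <= a.+1)%N ->
  ((a, c) == (b, c)) || gadj (a, c) (b, c).
Proof. by rewrite /gadj /nadj /toN /= !xpair_eqE -!val_eqE /=; lia. Qed.

Lemma gadj_col (a b c : 'I_N) : (a <= b.+1)%N -> (b <= a.+1)%N ->
  ((c, a) == (c, b)) || gadj (c, a) (c, b).
Proof. by rewrite /gadj /nadj /toN /= !xpair_eqE -!val_eqE /=; lia. Qed.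

End Grid.

(** * Discretization of a separated drawing *)

Section Discretize.
Variables (R : realType) (V : finType) (e : rel V).
Variables (pt : V -> R * R) (arc : {set V} -> set (R * R)) (r h M : R).
Hypotheses (es : symmetric e) (ei : irreflexive e).
Hypothesis pd : plane_drawing e pt arc.
Hypothesis sd : separated_drawing e pt arc r h M.

Let h0 : 0 < h. Proof. exact: sep_h sd. Qed.
Let hr : 4 * h <= r. Proof. exact: sep_r sd. Qed.

(* Grid coordinate [i] stands for the real number [i * h - M']. *)
Let M' : R := `|M| + 4 * r.
Let n : nat := (Num.truncn (2 * M' / h)).+2.
Let N := n.+1.
Notation P := ('I_N * 'I_N)%type.
Let g (i : nat) : R := i%:R * h - M'.
Let rho1 (x : R) : 'I_N := inord (Num.truncn ((x + M') / h)).
Let rho (x : R * R) : P := (rho1 x.1, rho1 x.2).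

Let near (p : P) (y : R * R) (d : R) : Prop :=
  `|g p.1 - y.1| <= d /\ `|g p.2 - y.2| <= d.

Lemma norm_coord (x y : R * R) d : `|x - y| <= d -> `|x.1 - y.1| <= d /\ `|x.2 - y.2| <= d.
Proof. by rewrite prod_normE /= ge_max => /andP[]. Qed.

Lemma coord_norm (x y : R * R) d : `|x.1 - y.1| <= d -> `|x.2 - y.2| <= d -> `|x - y| <= d.
Proof. by move=> h1 h2; rewrite prod_normE /= ge_max h1. Qed.

Lemma g_lt i j : (g i < g j) = (i < j)%N.
Proof. by rewrite /g ltrD2r ltr_pM2r // ltr_nat. Qed.

Lemma g_le i j : (g i <= g j) = (i <= j)%N.
Proof. by rewrite /g lerD2r ler_pM2r // ler_nat. Qed.

Lemma gS i : g i.+1 = g i + h.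
Proof. by rewrite /g -natr1 mulrDl mul1r; lra. Qed.

Lemma g0 : g 0 = - M'.
Proof. by rewrite /g mul0r add0r. Qed.

Lemma M'0 : 0 < M'.
Proof. have := normr_ge0 M; move: h0 hr; rewrite /M'; lra. Qed.

Lemma g_max i : g i <= M' -> (i < n)%N.
Proof.
move=> gi; rewrite /n ltnS; apply: (@leq_trans (Num.truncn (2 * M' / h))); last by [].
have z : 0 <= 2 * M' / h by rewrite divr_ge0 // ltW //; have := M'0; lra.
rewrite -(ler_nat R); apply: contraT; rewrite -ltNge => lt1.
have : ((Num.truncn (2 * M' / h)).+1 <= i)%N by rewrite -(ltr_nat R).
rewrite -(ler_nat R) => le2.
have /andP[_ lt2] := truncn_itv z.
have : 2 * M' / h < i%:R by exact: lt_le_trans lt2 le2.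
rewrite ltr_pdivrMr // => lt3; move: gi; rewrite /g; lra.
Qed.

Lemma rho1P x : `|x| <= M -> g (rho1 x) <= x < g (rho1 x) + h.
Proof.
move=> xM.
have xM' : `|x| <= `|M| by apply: le_trans xM (ler_norm _).
have [x1 x2] : - `|M| <= x /\ x <= `|M| by apply/andP; rewrite -ler_norml.
have z : 0 <= (x + M') / h.
  by rewrite divr_ge0 ?(ltW h0) //; rewrite /M'; move: h0 hr; lra.
have /andP[t1 t2] := truncn_itv z.
have E : g (Num.truncn ((x + M') / h)) <= x < g (Num.truncn ((x + M') / h)) + h.
  rewrite ler_pdivlMr // in t1; rewrite ltr_pdivrMr // -natr1 in t2.
  by rewrite /g; apply/andP; split; lra.
rewrite /rho1 inordK // ltnS; apply: ltnW; apply: g_max.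
case/andP: E => E _; rewrite /M'; move: h0 hr; lra.
Qed.

Lemma near_rho x : `|x| <= M -> near (rho x) x h.
Proof.
rewrite prod_normE ge_max => /andP[/rho1P/andP[a b] /rho1P/andP[c d]].
by split; rewrite ler_norml; apply/andP; split; rewrite /=; lra.
Qed.

(** The margin [4 * r] built into [M'] keeps grid points near the drawing off the border. *)
Lemma near_inner p y d : `|y| <= M -> d < 4 * r -> near p y d -> inner p.
Proof.
rewrite prod_normE ge_max => /andP[y1 y2] dr [].
have key (i : 'I_N) (z : R) : `|z| <= M -> `|g i - z| <= d -> (0 < i)%N && (i.+1 < N)%N.
  move=> zM; rewrite ler_norml => /andP[a b].
  have zM' : `|z| <= `|M| by apply: le_trans zM (ler_norm _).
  have [x1 x2] : - `|M| <= z /\ z <= `|M| by apply/andP; rewrite -ler_norml.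
  rewrite -g_lt g0; apply/andP; split; first by rewrite /M'; lra.
  by rewrite ltnS; apply: g_max; rewrite /M'; lra.
by move=> /(key _ _ y1)/andP[? ?] /(key _ _ y2)/andP[? ?]; apply/and4P.
Qed.

(** The radius exceeds [r + 2 * h]. Hence a grid point of [Q] outside [U v] comes from an arc point
    at distance at least [r] from [pt v], as [sep_arcs] requires. *)
Let U v : {set P} := [set p | `[< near p (pt v) (2 * r) >]].
(** The width [2 * h] makes room for the corner points inserted in [Q_connected]. *)
Let Q a : {set P} := [set p | `[< exists2 y, arc a y & near p y (2 * h) >]].

Lemma memU p v : reflect (near p (pt v) (2 * r)) (p \in U v).
Proof. by rewrite finset.in_set; exact: asboolP. Qed.

Lemma memQ p a : reflect (exists2 y, arc a y & near p y (2 * h)) (p \in Q a).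
Proof. by rewrite finset.in_set; exact: asboolP. Qed.

Lemma near_dist p x y d d' : near p x d -> near p y d' -> `|x - y| <= d + d'.
Proof.
move=> [a1 a2] [b1 b2]; apply: coord_norm.
  rewrite (_ : x.1 - y.1 = (g p.1 - y.1) - (g p.1 - x.1)); last by lra.
  by apply: le_trans (ler_normB _ _) _; lra.
rewrite (_ : x.2 - y.2 = (g p.2 - y.2) - (g p.2 - x.2)); last by lra.
by apply: le_trans (ler_normB _ _) _; lra.
Qed.

Lemma U_disjoint u v p : p \in U u -> p \in U v -> u = v.
Proof.
move=> /memU pu /memU pv; apply/eqP; apply: contraT => uv.
by have := sep_pt sd uv; have := near_dist pu pv; lra.
Qed.

Lemma U_center v : rho (pt v) \in U v.
Proof.
apply/memU; have [a b] := near_rho (sep_bound_pt sd v).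
by split; [move: a | move: b]; move: h0 hr; lra.
Qed.

(** [U v] is a full square of grid points: a row followed by a column leads to the centre. *)
Lemma U_connected v p : p \in U v -> connect (adj_in (U v)) p (rho (pt v)).
Proof.
have := U_center v; case: (rho (pt v)) => [i0 j0] c0 pU.
case: p pU => [i j] pU.
have conv (a b k : 'I_N) (x : R) : `|g a - x| <= 2 * r -> `|g b - x| <= 2 * r ->
    (a <= k <= b)%N -> `|g k - x| <= 2 * r.
  rewrite -!g_le !ler_norml => /andP[? ?] /andP[? ?] /andP[? ?].
  by apply/andP; split; lra.
move/memU: c0 => [c1 c2]; move/memU: pU => [p1 p2].
have sym := sym_connect_sym (adj_in_sym (U v)).
apply: (connect_trans (y := (i0, j))).
  case: (leqP i i0) => ii.
    apply: (@connect_row _ _ _ (i0 - i)%N); first by lia.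
    by move=> k hk; apply/memU; split=> //; exact: conv hk.
  rewrite sym; apply: (@connect_row _ _ _ (i - i0)%N); first by lia.
  by move=> k hk; apply/memU; split=> //; exact: conv hk.
case: (leqP j j0) => jj.
  apply: (@connect_col _ _ _ (j0 - j)%N); first by lia.
  by move=> k hk; apply/memU; split=> //; exact: conv hk.
rewrite sym; apply: (@connect_col _ _ _ (j - j0)%N); first by lia.
by move=> k hk; apply/memU; split=> //; exact: conv hk.
Qed.

Lemma rho1_close x y : `|x| <= M -> `|y| <= M -> `|x - y| < h ->
  (rho1 x <= (rho1 y).+1)%N && (rho1 y <= (rho1 x).+1)%N.
Proof.
move=> /rho1P/andP[x1 x2] /rho1P/andP[y1 y2]; rewrite ltr_norml => /andP[a b].
by apply/andP; split; rewrite -ltnS -g_lt !gS; lra.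
Qed.

Lemma Q_connected u v : e u v ->
  connect (adj_in (Q [set u; v])) (rho (pt u)) (rho (pt v)).
Proof.
move=> euv; have arcP := arc_ends pd euv.
have bd y : arc [set u; v] y -> `|y| <= M by move=> ay; exact: (sep_bound_arc sd euv ay).
apply: (@connected_chain_ind R (arc [set u; v]) h
  (fun y => connect (adj_in (Q [set u; v])) (rho (pt u)) (rho y)) (pt u)) => //.
- exact: arc_connected arcP.
- exact: arc_start arcP.
- move=> x y ax ay xy cx; apply: (connect_trans cx) => {cx}.
  have [xM yM] := (bd x ax, bd y ay).
  have [xy1 xy2] : `|x.1 - y.1| < h /\ `|x.2 - y.2| < h.
    by apply/andP; move: xy; rewrite prod_normE gt_max.
  have xM' := xM; have yM' := yM.
  rewrite prod_normE ge_max in xM'; rewrite prod_normE ge_max in yM'.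
  case/andP: xM' => xM1 xM2; case/andP: yM' => yM1 yM2.
  have /andP[i1 i2] := rho1_close xM1 yM1 xy1.
  have /andP[j1 j2] := rho1_close xM2 yM2 xy2.
  have [nx1 nx2] := near_rho xM; have [ny1 ny2] := near_rho yM.
  have Qx : rho x \in Q [set u; v].
    by apply/memQ; exists x => //; split; move: nx1 nx2; move: h0; lra.
  have Qy : rho y \in Q [set u; v].
    by apply/memQ; exists y => //; split; move: ny1 ny2; move: h0; lra.
  (* The roundings of [x] and [y] may differ in both coordinates; this corner point joins them. *)
  have Qc : (rho1 y.1, rho1 x.2) \in Q [set u; v].
    apply/memQ; exists x => //; split=> /=; last by move: nx2 h0 => /=; lra.
    rewrite (_ : g (rho1 y.1) - x.1 = (g (rho1 y.1) - y.1) - (x.1 - y.1)); last by lra.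
    by apply: le_trans (ler_normB _ _) _; move: ny1 => /=; lra.
  have step (a b : P) : a \in Q [set u; v] -> b \in Q [set u; v] ->
      (a == b) || gadj a b -> connect (adj_in (Q [set u; v])) a b.
    move=> aQ bQ /orP[/eqP -> //|ga]; apply: connect1.
    by rewrite /adj_in aQ bQ.
  apply: (connect_trans (y := (rho1 y.1, rho1 x.2))); apply: step => //.
    exact: gadj_row.
  exact: gadj_col.
- exact: arc_stop arcP.
Qed.

Lemma bridge u v : e u v -> exists x q y,
  [/\ x \in U u, y \in U v, path (@gadj N) x (rcons q y)
    & forall z, z \in q -> [/\ z \in Q [set u; v], z \notin U u & z \notin U v]].
Proof.
move=> euv; have uv : u != v by apply: contraTneq euv => ->; rewrite ei.
have /connectP[p pth lst] := Q_connected euv.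
have dis : [disjoint U u & U v].
  apply/pred0P => p' /=; apply/negP => /andP[pu pv].
  by rewrite (U_disjoint pu pv) eqxx in uv.
have [||||x [q [y [xU yU pq qout]]]] := @path_between _ (adj_in (Q [set u; v])) _ _ p dis (rho (pt u)) [::].
- exact: U_center.
- by [].
- exact: pth.
- by rewrite /= -lst U_center.
exists x, q, y; split=> //.
  by apply: sub_path pq => a b /and3P[].
move=> z zq; have := qout z zq; rewrite inE negb_or => /andP[zu zv]; split=> //.
have /allP := path_all_target (Q := mem (Q [set u; v])) (fun a b => fun h : adj_in _ a b => proj1 (andP (proj2 (andP h)))) pq.
by apply; rewrite mem_rcons inE zq orbT.
Qed.

Lemma grid_minor : exists (N : nat) (X : V -> {set 'I_N * 'I_N}),
  [/\ forall u v x, x \in X u -> x \in X v -> u = v,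
      forall v x, x \in X v -> inner x,
      forall v x y, x \in X v -> y \in X v ->
        connect (fun a b => [&& a \in X v, b \in X v & gadj a b]) x y,
      forall v, exists x, x \in X v
    & forall u v, e u v -> exists x y, [/\ x \in X u, y \in X v & gadj x y]].
Proof.
have H (i : 'I_#|edges e|) : exists q : (V * V) * ((P * P) * seq P),
    [/\ e q.1.1 q.1.2, ev i = [set q.1.1; q.1.2],
      q.2.1.1 \in U q.1.1 /\ q.2.1.2 \in U q.1.2,
      path (@gadj N) q.2.1.1 (rcons q.2.2 q.2.1.2)
      & forall z, z \in q.2.2 -> [/\ z \in Q (ev i), z \notin U q.1.1 & z \notin U q.1.2]].
  have /edgesP[u [v [euv evE]]] := enum_valP i.
  have [x [q [y [xU yU pq qout]]]] := bridge euv.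
  by exists ((u, v), ((x, y), q)); rewrite /ev evE.
have [f fP] := fin_all_exists H.
(* Each bridge goes to the branch set of its first end, and its last grid edge then joins the two
   branch sets. *)
pose X v := U v :|: [set p | [exists i, ((f i).1.1 == v) && (p \in (f i).2.2)]].
have XP v p : p \in X v -> p \in U v \/ exists2 i, (f i).1.1 = v & p \in (f i).2.2.
  rewrite inE => /orP[|]; first by left.
  by rewrite inE => /existsP[i /andP[/eqP <- pi]]; right; exists i.
have qfar i p : p \in (f i).2.2 -> exists y, [/\ arc (ev i) y, near p y (2 * h)
    & forall w, r <= `|pt w - y|].
  move=> pi; have [euv evE _ _ qo] := fP i; have [pQ pu pv] := qo p pi.
  case/memQ: pQ => y ay py; exists y; split=> // w.
  have [wuv|wuv] := boolP (w \in [set (f i).1.1; (f i).1.2]); last first.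
    rewrite evE in ay; have := sep_pt_arc sd euv wuv ay.
    by move: h0 hr; lra.
  have pw : p \notin U w by move: wuv => /set2P[] ->.
  apply: contraNT pw; rewrite -ltNge => lt1; apply/memU.
  have [a b] := norm_coord (ltW lt1); case: py => c d; split.
    rewrite (_ : g p.1 - (pt w).1 = (g p.1 - y.1) - ((pt w).1 - y.1)); last by lra.
    by apply: le_trans (ler_normB _ _) _; move: h0 hr; lra.
  rewrite (_ : g p.2 - (pt w).2 = (g p.2 - y.2) - ((pt w).2 - y.2)); last by lra.
  by apply: le_trans (ler_normB _ _) _; move: h0 hr; lra.
(* A bridge avoids the squares of its own ends by construction and all others by [sep_pt_arc]. *)
have Uq u i p : p \in U u -> p \in (f i).2.2 -> False.
  move=> pU pi; have [euv evE _ _ qo] := fP i; have [pQ pu pv] := qo p pi.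
  have uo : u \notin [set (f i).1.1; (f i).1.2].
    by apply/negP => /set2P[] uE; rewrite uE in pU; [rewrite pU in pu | rewrite pU in pv].
  rewrite evE in pQ; case/memQ: pQ => y ay py; move/memU: pU => pU.
  by have := sep_pt_arc sd euv uo ay; have := near_dist pU py; move: h0 hr; lra.
exists N, X; split.
- move=> u v p /XP[pu|[i iu pi]] /XP[pv|[j jv pj]].
  + exact: U_disjoint pu pv.
  + by case: (Uq u j p).
  + by case: (Uq v i p).
  (* A common point of two bridges would bring two arcs within [4 * h] of each other away from the
     vertices. *)
  + have [ij|ij] := eqVneq i j; first by rewrite -iu -jv ij.
    exfalso; have [eu evi _ _ _] := fP i; have [eu' evj _ _ _] := fP j.
    have ne : [set (f i).1.1; (f i).1.2] <> [set (f j).1.1; (f j).1.2].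
      by rewrite -evi -evj => /ev_inj/eqP; rewrite (negbTE ij).
    have [y [ay py fy]] := qfar i p pi; have [y' [ay' py' fy']] := qfar j p pj.
    rewrite evi in ay; rewrite evj in ay'.
    by have := sep_arcs sd eu eu' ne ay ay' fy fy'; have := near_dist py py'; lra.
- move=> v p /XP[|[i iv pi]].
    move=> /memU; apply: near_inner; first exact: sep_bound_pt sd v.
    by move: h0 hr; lra.
  have [y [ay py _]] := qfar i p pi; apply: near_inner py; last by move: h0 hr; lra.
  have [euv evE _ _ _] := fP i; rewrite evE in ay; exact: (sep_bound_arc sd euv ay).
- have UX v : U v \subset X v by exact: finset.subsetUl.
  have sym v := sym_connect_sym (adj_in_sym (X v)).
  have toc v p : p \in X v -> connect (adj_in (X v)) p (rho (pt v)).
    move=> /XP[pU|[i iv pi]]; first exact: adj_in_sub (UX v) (U_connected pU).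
    have [euv evE [xU _] pq _] := fP i.
    apply: (connect_trans (y := (f i).2.1.1)); last first.
      by apply: adj_in_sub (UX v) _; rewrite -iv; exact: U_connected.
    rewrite sym.
    have qX z : z \in (f i).2.2 -> z \in X v.
      by move=> zi; rewrite !inE; apply/orP; right; apply/existsP; exists i; rewrite iv eqxx.
    have xX : (f i).2.1.1 \in X v by rewrite (fintype.subsetP (UX v)) // -iv.
    move: pq pi; rewrite rcons_path => /andP[pq _].
    elim: (f i).2.2 (f i).2.1.1 xX pq qX => //= z q IH x xX /andP[xz zq] qX.
    have zX : z \in X v by apply: qX; rewrite mem_head.
    have xzc : connect (adj_in (X v)) x z by apply: connect1; rewrite /adj_in xX zX.
    rewrite inE => /orP[/eqP -> //|pq]; apply: connect_trans xzc _.
    by apply: IH => // w wq; apply: qX; rewrite inE wq orbT.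
  by move=> v x y xX yX; apply: connect_trans (toc _ _ xX) _; rewrite -/(adj_in (X v)) sym toc.
- by move=> v; exists (rho (pt v)); rewrite inE U_center.
- move=> u v euv.
  have [i evi] : exists i : 'I_#|edges e|, ev i = [set u; v].
    have aE : [set u; v] \in edges e by rewrite mem_edges.
    by exists (enum_rank_in aE [set u; v]); rewrite /ev enum_rankK_in.
  have [_ evE [xU yU] pq _] := fP i.
  have [x [y [xX yX ga]]] : exists x y, [/\ x \in X (f i).1.1, y \in X (f i).1.2 & gadj x y].
    exists (last (f i).2.1.1 (f i).2.2), (f i).2.1.2; split.
    - have := mem_last (f i).2.1.1 (f i).2.2; rewrite inE => /orP[/eqP ->|li].
        by rewrite inE xU.
      by rewrite !inE; apply/orP; right; apply/existsP; exists i; rewrite eqxx.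
    - by rewrite inE yU.
    - by move: pq; rewrite rcons_path => /andP[].
  have /eqP := evE; rewrite evi eq_set2 => /orP[]/andP[/eqP -> /eqP ->].
    by exists x, y.
  by exists y, x; rewrite gadjC.
Qed.

End Discretize.

End Drawings.

(** * Planar graphs without 4-cycles and the induction *)

Section PlanarNoFourCycle.
Variables (R : realType).

Definition four_cycle_free (V : finType) (e : rel V) : Prop := forall a b c d,
  e a b -> e b c -> e c d -> e d a -> a != c -> b != d -> False.

Lemma no_4cycle_free (V : finType) (e : rel V) :
  irreflexive e -> ~ has_4cycle e -> four_cycle_free e.
Proof.
move=> ei no4 a b c d ab bc cd da ac bd; apply: no4; exists [:: a; b; c; d] => //.
have ne x y : e x y -> x != y by apply: contraTneq => ->; rewrite ei.
rewrite /ucycle /= ab bc cd da /= !inE !negb_or ac bd (ne a b) // (ne b c) // (ne c d) //.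
by rewrite eq_sym (ne d a).
Qed.

Lemma planar_light (V : finType) (e : rel V) :
  symmetric e -> irreflexive e -> planar R e -> four_cycle_free e -> 0 < #|V| ->
  (exists v, deg e v <= 3) \/
  (exists w x y z, [/\ uniq [:: w; x; y; z], [/\ e w x, e w y, e w z & e x y]
    & [/\ deg e w <= 4, deg e x <= 4, deg e y <= 4 & deg e z <= 4]]).
Proof.
move=> es ei [pt [arc pd]] no4 V0.
have [r [h [M sd]]] := drawing_separated pd.
have [N [X [Xd Xi Xc X0 Xa]]] := grid_minor es ei pd sd.
have [k [B [Bi Be B0 B2 kV]]] := grid_minor_rows es ei V0 Xd Xi Xc X0 Xa.
exact: (light_configuration es ei no4 Bi Be B0 B2 kV).
Qed.

Lemma planar_induced (V : finType) (e : rel V) (S : {set V}) :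
  planar R e -> planar R (fun u v : {x | x \in S} => e (val u) (val v)).
Proof.
case=> pt [arc pd]; pose T : finType := {x | x \in S}.
exists (fun u : T => pt (val u)), (fun A : {set T} => arc [set val x | x in A]%SET).
have im2 (u v : T) : [set val x | x in [set u; v]]%SET = [set val u; val v]%SET.
  by rewrite imsetU1 imset_set1.
split.
- by move=> u v /(pt_inj pd)/val_inj.
- by move=> u v euv; rewrite im2; exact: arc_ends pd _ _ euv.
- move=> u v w euv; rewrite im2 => /(arc_avoids_vertices pd euv).
  by case/set2P=> /val_inj ->; rewrite ?set21 ?set22.
- move=> u v x y euv exy ne; rewrite !im2 => p pp.
  have ne' : [set val u; val v]%SET <> [set val x; val y]%SET.
    by rewrite -!im2 => /imset_inj -/(_ val_inj).
  have [w [w1 w2] <-] := arcs_meet_at_common_ends pd euv exy ne' pp.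
  rewrite -im2 in w1; rewrite -im2 in w2.
  case/imsetP: w1 w2 => z z1 -> /imsetP[z' z2 /val_inj zz]; exists z => //.
  by split=> //; rewrite zz.
Qed.

Lemma deg_induced (V : finType) (e : rel V) (S : {set V}) (v : {x | x \in S}) :
  deg (fun u v : {x | x \in S} => e (val u) (val v)) v = #|nbrs_in e S (val v)|.
Proof.
rewrite /deg -(card_imset _ val_inj); apply: eq_card => x; rewrite !finset.inE.
apply/imsetP/andP => [[y + ->]|[xS evx]]; first by rewrite finset.inE => h; split=> //; exact: valP.
by exists (exist _ x xS) => //; rewrite finset.inE.
Qed.

(** The light configuration is taken in the graph induced on [S], whose degrees are the counts in
    [nbrs_in]; removing it makes [S] smaller. *)
Lemma planar_reconfigurable (V : finType) (e : rel V) (C : eqType) (L : V -> C -> Prop) :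
  symmetric e -> irreflexive e -> planar R e -> four_cycle_free e ->
  (forall v, exists2 l : seq C, uniq l /\ size l = 8 & forall c, c \in l -> L v c) ->
  forall S, reconfigurable e L 29 S.
Proof.
move=> es ei pl no4 L8 S; have [n] := ubnP #|S|; elim: n S => // n IH S /ltnSE Sn.
have [->|/set0Pn[v0 v0S]] := eqVneq S finset.set0.
  by move=> a b _ _; exists [::] => //; split=> // w; rewrite finset.in_set0.
have lt (S' : {set V}) v : v \in S -> S' \subset S -> v \notin S' -> #|S'| < n.
  move=> vS sS vS'; apply: leq_trans Sn; apply: proper_card.
  by apply/properP; split=> //; exists v.
pose e' := fun u v : {x | x \in S} => e (val u) (val v).
have [|||||[v d3]|[w [x [y [z [u4 [ewx ewy ewz exy] [dw dx dy dz]]]]]]] := @planar_light _ e'.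
- by move=> u v; exact: es.
- by move=> u; exact: ei.
- exact: planar_induced.
- by move=> a b c d; exact: no4.
- by apply/card_gt0P; exists (exist _ v0 v0S).
- rewrite deg_induced in d3; have vS := valP v.
  apply: (@reconfigurable_deg3 _ e _ L L8 es ei S (val v)) => //; apply: IH.
  by apply: (lt _ (val v)) => //; [exact: subD1set | rewrite !finset.inE eqxx].
- rewrite !deg_induced in dw dx dy dz.
  apply: (@reconfigurable_bowtie _ e _ L L8 es ei S (val w) (val x) (val y) (val z)) => //.
  + by split; exact: valP.
  + apply: IH; apply: (lt _ (val w)); first exact: valP.
      exact: finset.subsetDl.
    by rewrite !finset.inE !eqxx.
Qed.

End PlanarNoFourCycle.

(** * From recoloring sequences to walks *)

Section Walks.
Variables (V : finType) (e : rel V) (C : Type) (L : V -> set C).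
Hypotheses (es : symmetric e).

Lemma valid_walk (s : seq (V * {classic C})) :
  forall (a b : @recoloring_vertex V e C L),
  @valid V e {classic C} L [set: V]%SET (sval a) s ->
  (forall w, @final V {classic C} (sval a) s w = sval b w) ->
  exists2 k, k <= size s & walk (@recoloring_adj V e C L) k a b.
Proof.
elim: s => [|[v c] s IH] [a Ha] [b Hb] /=.
  move=> _ ab; exists 0 => //.
  have E : a = b by apply/funext.
  by subst b; rewrite (Prop_irrelevance Ha Hb); exact: walk_nil.
case=> _ Lc pc va fa.
pose a' : V -> C := @upd V {classic C} a v c.
have Ha' : @list_coloring V e C L a'.
  case: Ha => La pa; split=> [w|u w euw]; rewrite /a' /upd; first by case: eqP => [->|].
  case: (eqVneq u v) (eqVneq w v) => [uv|uv] [wv|wv].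
  - by have := pc w (finset.in_setT _); subst; move=> /(_ euw); case: (pa _ _ euw).
  - by apply: pc; rewrite ?finset.in_setT // -uv.
  - by apply/nesym; apply: pc; rewrite ?finset.in_setT // es -wv.
  - exact: pa.
have [k ks wk] := IH (exist _ a' Ha') (exist _ b Hb) va fa.
(* A step repeating the present colour is no edge of the recoloring graph and is skipped. *)
have [ac|ac] := pselect (a v = c).
  have E : a' = a by apply/funext => w; rewrite /a' /upd; case: eqP => // ->.
  exists k; first exact: leqW.
  suff -> : exist _ a Ha = exist _ a' Ha' :> recoloring_vertex e L by [].
  by apply: eq_exist; rewrite E.
exists k.+1 => //; apply: walk_step wk.
exists v; split=> /=; first by rewrite /a' /upd eqxx.
by move=> w; rewrite /a' /upd; case: eqP.
Qed.

End Walks.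

Lemma size_steps (V : finType) (C : eqType) (s : seq (V * C)) :
  size s = \sum_v steps_at v s.
Proof.
elim: s => [|p s IH]; first by rewrite big1.
transitivity (\sum_v ((p.1 == v) + steps_at v s)); last by [].
rewrite /= IH -add1n big_split /=; congr addn; rewrite (bigD1 p.1) //= eqxx big1 // => v.
by rewrite eq_sym => /negbTE ->.
Qed.

Local Open Scope ring_scope.
Local Open Scope classical_set_scope.
Local Open Scope card_scope.

Theorem theorem4 (R : realType) (V : finType) (e : rel V)
    (e_sym : symmetric e) (e_irrefl : irreflexive e)
    (e_planar : planar R e) (e_no4 : ~ has_4cycle e)
    (C : Type) (L : V -> set C) (L_ge8 : forall v : V, `I_8 #<= L v) :
  (diam R (@recoloring_adj V e C L) <= ((29 * #|V|)%:R)%:E)%E.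
Proof.
(* [{classic C}] is [C] with classical decidable equality. The 8 colours are the images under an
   injection of [I_8] into [L v]. *)
have L8 v : exists2 l : seq {classic C}, uniq l /\ size l = 8%N & forall c, c \in l -> L v c.
  have /card_leP[f] := L_ge8 v.
  pose k (i : 'I_8) : set_type `I_8 := exist _ (i : nat) (mem_set (ltn_ord i)).
  exists [seq (val (f (k i)) : {classic C}) | i <- enum 'I_8].
    split; last by rewrite size_map size_enum_ord.
    rewrite map_inj_uniq ?enum_uniq // => i j /val_inj/(@inj _ _ _ f).
    move=> h; apply: val_inj; exact: (congr1 val (h (mem_set I) (mem_set I))).
  by move=> c /mapP[i _ ->]; exact: (set_mem (valP (f (k i)))).
have rec := @planar_reconfigurable R V e {classic C} L e_sym e_irrefl e_planar
  (no_4cycle_free e_irrefl e_no4) L8 [set: V]%SET.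
apply: ge_ereal_sup => _ [a _ [b _ <-]].
have pr (c : recoloring_vertex e L) : @proper_on V e {classic C} L [set: V]%SET (sval c).
  by case: c => c [Lc pc]; split=> [v _|u v _ _]; [exact: Lc | exact: pc].
have [s [va fa] ks] := rec _ _ (pr a) (pr b).
have [|k ks' wk] := @valid_walk V e C L e_sym s a b va.
  by move=> w; apply: fa; rewrite finset.in_setT.
apply: (@le_trans _ _ (k%:R)%:E).
  by apply: ereal_inf_lbound; exists k.
rewrite lee_fin ler_nat; apply: (leq_trans ks').
rewrite size_steps mulnC -[X in (X * _)%N]/#|V| -sum_nat_const; apply: leq_sum => v _.
exact: ks.
Qed.
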